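(* Let $Y$ be a random simplicial complex on $[n]=\{0,\dots,n\}$ drawn from the lower model with a homogeneous system of probability parameters in the medial regime, with constants $0<p\le P<1$ such that $p\le p_\sigma\le P$ for all $\sigma$. Then for any constant $\delta_0>0$, asymptotically almost surely, $H_j(Y;\mathbb Q)=0$ for all $0<j\le\log_2\log_{(p^{-1})}n-1-\delta_0$.
   Context: Lower model: each non-empty proper subset $\sigma\subsetneq[n]$ is included independently with probability $p_\sigma$ into a random hypergraph $X$, and $Y$ is the largest simplicial complex contained in $X$ ($\sigma\in Y$ iff every non-empty $\tau\subseteq\sigma$ lies in $X$). Medial regime: $p,P\in(0,1)$ are independent of $n$. Homogeneous: $p_\sigma=p_{\sigma'}$ whenever $\dim\sigma=\dim\sigma'$ (where $\dim\sigma=|\sigma|-1$). Asymptotically almost surely means with probability tending to $1$ as $n\to\infty$. *)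

(* Defs.v *)
From HB Require Import structures.
From mathcomp Require Import all_boot all_order all_algebra.
From mathcomp Require Import all_classical all_reals all_analysis.
Set Implicit Arguments. Unset Strict Implicit. Unset Printing Implicit Defensive.
Import Order.TTheory GRing.Theory Num.Theory.
Local Open Scope ring_scope.

(* Vertex set [n] = {0,...,n} is 'I_n.+1; faces/hyperedges are {set 'I_N}. *)

Section Simplicial.
Variable N : nat.
Notation V := 'I_N.

Definition proper_faces : {set {set V}} :=
  [set s : {set V} | (s != finset.set0) && (s != finset.setT)].

(* Largest simplicial complex contained in the hypergraph X:
   sigma in Y iff sigma nonempty and every non-empty tau ⊆ sigma lies in X. *)
Definition lowerY (X : {set {set V}}) : {set {set V}} :=
  [set s : {set V} | (s != finset.set0) &&
     [forall t : {set V}, ((t != finset.set0) && (t \subset s)) ==> (t \in X)]].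

Definition lower_weight (R : pzRingType) (ps : {set V} -> R) (X : {set {set V}}) : R :=
  if X \subset proper_faces then
    \prod_(s in proper_faces) (if s \in X then ps s else 1 - ps s)
  else 0.

Definition faces (Y : {set {set V}}) (k : nat) : {set {set V}} :=
  [set s in Y | #|s| == k.+1].

(* Oriented incidence coefficient [s : t] (vertices ordered increasingly):
   if t = s \ {v}, it is (-1)^(#vertices of s below v), else 0. *)
Definition incidence (s t : {set V}) : rat :=
  if (t \subset s) && (#|s| == #|t|.+1) then
    \sum_(v in s :\: t) (-1) ^+ #|[set u in s | (u < v)%N]|
  else 0.

(* Matrix of the boundary map C_j(Y;Q) -> C_{j-1}(Y;Q), j >= 1, acting on
   row vectors: rows = j-faces, columns = (j-1)-faces of Y. *)
Definition bdry (Y : {set {set V}}) (j : nat) :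
  'M[rat]_(#|faces Y j|, #|faces Y j.-1|) :=
  \matrix_(i, k) incidence (enum_val i) (enum_val k).

(* H_j(Y;Q) = ker d_j / im d_{j+1} = 0  (for j >= 1). *)
Definition homology_vanishes (Y : {set {set V}}) (j : nat) : bool :=
  (kermx (bdry Y j) <= bdry Y j.+1)%MS.

End Simplicial.

Definition lower_prob (R : pzRingType) (n : nat) (ps : {set 'I_n.+1} -> R)
  (E : {set {set 'I_n.+1}} -> bool) : R :=
  \sum_(X : {set {set 'I_n.+1}} | E (lowerY X)) lower_weight ps X.

Definition logb (R : realType) (b x : R) : R := ln x / ln b.

(* Main.v *)
Require Import Defs.
From HB Require Import structures.
From mathcomp Require Import all_boot all_order all_algebra.
From mathcomp Require Import ring lra zify.
Set Implicit Arguments. Unset Strict Implicit. Unset Printing Implicit Defensive.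
Import Order.TTheory GRing.Theory Num.Theory.
Local Open Scope ring_scope.

(* Garland's method, unweighted. Let phi be a harmonic j-cochain of Y. For a
   (j-1)-face t put x_t(v) = +-phi(t + v); the entries of x_t sum to 0, and
   summing over t the quadratic forms of the link graphs of the faces t at x_t
   gives, by the cocycle identity, the sum over the j-faces s of
   deg(s) phi(s)^2. Hence phi = 0 as soon as every degree is at least D and
   every link graph, once its edge indicators are centered at their mean, has
   largest eigenvalue at most lam with (j+1) lam < D.

   With q' and q the conditional probabilities of a vertex and of an edge of a
   link, N = n + 1 and d = N q' q, degrees concentrate around d, while the trace
   of the K-th power of the centered link matrix has expectation about
   d^(K/2): closed walks that use some edge exactly once contribute 0, and the
   others visit at most K/2 + 1 vertices. The hypothesis on j says that
   2^(j+1) <= 2^(-delta0) log_(1/p) n, so d >= n^eps with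
   eps = 1 - 2^(-delta0). Taking K a large multiple of 2^(j+1) makes the
   failure probability small enough to beat the union bound over the at most
   N^(j+1) faces. *)

(** * Garland's criterion *)

(** The pairs on both sides correspond through [(A, v) -> (v |: A, v)]. This double counting passes
    between faces with an added vertex and faces with a removed one. *)
Lemma sum_setU1_setD1 (T : finType) (M : nmodType) (G : {set T} -> T -> M) :
  \sum_(A : {set T}) \sum_(v | v \notin A) G A v =
  \sum_(A : {set T}) \sum_(v in A) G (A :\ v) v.
Proof.
rewrite !pair_big_dep /=.
rewrite (reindex_onto (fun x : {set T} * T => (x.1 :\ x.2, x.2))
                      (fun x => (x.2 |: x.1, x.2))) /=.
  apply: eq_bigl => -[A v] /=; rewrite setD11 /=.
  apply/eqP/idP => [[<-]|vA]; first by rewrite setU11.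
  by rewrite setD1K.
by move=> [A v] /= vA; rewrite setU1K.
Qed.

Section Incidence.
Variable N : nat.
Implicit Types (s t : {set 'I_N}) (u v : 'I_N).

Lemma incidence_setU1 t v : v \notin t ->
  incidence (v |: t) t = (-1) ^+ #|[set u in t | (u < v)%N]|.
Proof.
move=> vt; rewrite /incidence finset.subsetU1 cardsU1 vt eqxx /=.
have -> : (v |: t) :\: t = [set v].
  by apply/setP => w; rewrite !inE; case: eqVneq => [->|_] /=; rewrite ?vt // andNb.
rewrite big_set1; congr (_ ^+ #|pred_of_set _|).
by apply/setP => w; rewrite !inE; case: eqVneq => [->|//]; rewrite ltnn (negPf vt).
Qed.

Lemma incidence_neq0 s t : incidence s t != 0 ->
  exists2 v, v \notin t & s = v |: t.
Proof.
rewrite /incidence; case: ifP => [/andP[ts /eqP sz] _|]; last by rewrite eqxx.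
have : #|s :\: t| == 1%N by rewrite cardsDS // sz subSnn.
case/cards1P => v /setP stv; have := stv v; rewrite !inE eqxx => /andP[vt vs].
exists v => //; apply/setP => w; have := stv w; rewrite !inE.
case: (w =P v) => [->|_] //=; case: (boolP (w \in t)) => //= wt _.
by rewrite (subsetP ts).
Qed.

Lemma incidence_sqr t v : v \notin t -> incidence (v |: t) t ^+ 2 = 1.
Proof. by move=> vt; rewrite incidence_setU1 // sqrr_sign. Qed.

Lemma card_below_setU1 t u v : u \notin t ->
  #|[set w in u |: t | (w < v)%N]| = ((u < v) + #|[set w in t | (w < v)%N]|)%N.
Proof.
move=> ut; case: ltnP => uv.
  have -> : [set w in u |: t | (w < v)%N] = u |: [set w in t | (w < v)%N].
    by apply/setP => w; rewrite !inE; case: eqVneq => [->|].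
  by rewrite cardsU1 inE (negPf ut).
rewrite add0n; apply: eq_card => w; rewrite !inE; case: eqVneq => [->|] //=.
by rewrite ltnNge uv /= andbF.
Qed.

(** Exactly one of [u < v] and [v < u] holds, so inserting both vertices flips exactly one of the
    two signs. This anticommutation yields both the vanishing of the double boundary and Garland's
    identity. *)
Lemma incidence_square t u v : u != v -> u \notin t -> v \notin t ->
  incidence (u |: t) t * incidence (v |: t) t =
  - (incidence (v |: (u |: t)) (u |: t) * incidence (u |: (v |: t)) (v |: t)).
Proof.
move=> uv ut vt.
rewrite !incidence_setU1 ?inE ?negb_or ?uv ?ut ?vt //=; last by rewrite eq_sym uv.
rewrite !card_below_setU1 // !exprD.
set a := _ ^+ #|_|; set b := _ ^+ #|_|.
have : nat_of_ord u != v by [].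
rewrite neq_ltn; case: ltngtP => //= _ _; ring.
Qed.

End Incidence.

Section Garland.
Variables (N : nat) (Y : {set {set 'I_N}}).
Hypothesis Y_closed : forall s t : {set 'I_N},
  s \in Y -> t != finset.set0 -> t \subset s -> t \in Y.
Implicit Types (s t : {set 'I_N}) (u v : 'I_N).

Lemma faces_setD1 k s v : s \in faces Y k.+1 -> v \in s -> s :\ v \in faces Y k.
Proof.
rewrite !inE => /andP[sY /eqP sz] vs.
have szD : #|s :\ v| = k.+1 by move: sz; rewrite (cardsD1 v) vs => -[].
rewrite szD eqxx andbT (Y_closed sY) ?subD1set //.
by rewrite -card_gt0 szD.
Qed.

(** Closure puts every [s :\ v] in [faces Y k], and distinct [v] give distinct facets, so
    restricting the sum to faces of [Y] loses no term. *)
Lemma sum_facets (R : nmodType) k s (G : {set 'I_N} -> R) :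
    s \in faces Y k.+1 ->
    (forall t, G t != 0 -> exists2 v, v \notin t & s = v |: t) ->
  \sum_(t in faces Y k) G t = \sum_(v in s) G (s :\ v).
Proof.
move=> sY Gs; have injD : {in s &, injective (fun v => s :\ v)}.
  move=> u v us vs /setP/(_ u); rewrite !inE eqxx us andbT /=.
  by move=> uNv; apply/eqP; rewrite -[_ == _]negbK -[u != v]andbT -uNv.
rewrite -(big_imset G injD) /=.
rewrite (bigID [pred t | t \in [set s :\ v | v in s]]) /= addrC big1 ?add0r.
  apply: eq_bigl => t; case: imsetP => [[v vs ->]|_]; rewrite ?andbF //.
  by rewrite (faces_setD1 sY vs).
move=> t /andP[_ tNs]; apply/eqP; apply: contraNT tNs => /Gs[v vt s_eq].
by apply/imsetP; exists v; rewrite s_eq ?setU11 // setU1K.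
Qed.

Lemma sum_cofacets (R : nmodType) t (G : {set 'I_N} -> R) :
    (forall s, G s != 0 -> exists2 v, v \notin t & s = v |: t) ->
  \sum_s G s = \sum_(v | v \notin t) G (v |: t).
Proof.
move=> Gs; have injU : {in [pred v | v \notin t] &, injective (fun v => v |: t)}.
  move=> u v ut vt /setP/(_ u); rewrite !inE eqxx /= => /esym.
  by move: ut; rewrite inE => /negPf ->; rewrite orbF => /eqP.
rewrite -(big_imset G injU) /=.
rewrite (bigID [pred s | s \in [set v |: t | v in [pred v | v \notin t]]]) /=.
rewrite addrC big1 ?add0r // => s tNs.
apply/eqP; apply: contraNT tNs => /Gs[v vt s_eq].
by apply/imsetP; exists v.
Qed.

(** An entry at [(r, t)] can be nonzero only when [r] is [t] with two more vertices; the two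
    intermediate faces then cancel by [incidence_square]. *)
Lemma bdry_bdry k : bdry Y k.+2 *m bdry Y k.+1 = 0.
Proof.
apply/matrixP => i l; rewrite !mxE.
under eq_bigr => m _ do rewrite !mxE.
have := enum_valP i; have := enum_valP l; move: (enum_val i) (enum_val l) => r t tY rY.
rewrite -(big_enum_val (fun s => incidence r s * incidence s t)) /=.
rewrite (sum_facets rY); last first.
  by move=> s; rewrite mulf_eq0 negb_or => /andP[/incidence_neq0].
case: (boolP ((t \subset r) && (#|r :\: t| == 2%N))) => [/andP[tr]|tNr].
  case/cards2P => u [v] [uv rt].
  have ut : u \notin t by have := set21 u v; rewrite -rt inE => /andP[].
  have vt : v \notin t by have := set22 u v; rewrite -rt inE => /andP[].
  have r_eq : r = u |: (v |: t).
    apply/setP => w; move/setP/(_ w): (rt); rewrite !inE.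
    by case: (boolP (w \in t)) => [/(subsetP tr) -> _|_ /= ->]; rewrite ?orbT ?orbF.
  have r_eq' : r = v |: (u |: t) by rewrite r_eq setUCA.
  have uvt : u \notin v |: t by rewrite !inE negb_or uv.
  have vut : v \notin u |: t by rewrite !inE negb_or eq_sym uv.
  rewrite (bigD1 u) /=; last by rewrite r_eq setU11.
  rewrite (bigD1 v) /=; last by rewrite r_eq' setU11 eq_sym.
  rewrite big1 => [|w /andP[/andP[wr wu] wv]]; last first.
    apply/eqP; rewrite mulf_eq0 orbC; apply/orP; left.
    apply/negPn/negP => /incidence_neq0[x xt /setP rw].
    have wt : w \in t by move: wr; rewrite r_eq !inE (negPf wu) (negPf wv).
    by have := rw w; rewrite !inE eqxx wt orbT.
  have -> : r :\ u = v |: t by rewrite r_eq setU1K.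
  have -> : r :\ v = u |: t by rewrite r_eq' setU1K.
  have := incidence_square uv ut vt; rewrite -r_eq -r_eq' addr0.
  have := incidence_sqr ut; have := incidence_sqr uvt; rewrite -r_eq.
  set A := incidence (u |: t) t; set B := incidence (v |: t) t.
  set C := incidence r (v |: t); set D := incidence r (u |: t) => C1 A1 ABCD.
  (* As [C ^+ 2 = 1], the square relation can be solved for [D]. *)
  have -> : D = - (A * B) * C by rewrite ABCD opprK -mulrA -expr2 C1 mulr1.
  have -> : C * B + - (A * B) * C * A = (1 - A ^+ 2) * (C * B) by ring.
  by rewrite A1 subrr mul0r.
rewrite big1 // => v vr; apply/eqP; apply: contraNT tNr.
rewrite mulf_eq0 negb_or => /andP[_ /incidence_neq0[u ut ruv]].
have r_eq : r = v |: (u |: t) by rewrite -ruv setD1K.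
have vut : v \notin u |: t by rewrite -ruv setD11.
have tr : t \subset r by rewrite r_eq setUA finset.subsetUr.
by rewrite tr cardsDS // r_eq !cardsU1 vut ut /= addnA addnK.
Qed.


(** Here j is [k.+1], and [phi] is extended by 0 to all vertex sets. The sum [Q] of the link forms
    is bounded above by the spectral hypothesis and below by the cocycle and degree hypotheses. This
    gives [D * S <= k.+2%:R * lam * S] for the squared norm [S] of [phi], so [S] cannot be
    positive. *)
Lemma garland (R : realFieldType) k (phi : {set 'I_N} -> R) (lam D : R) :
    (forall s, s \notin faces Y k.+1 -> phi s = 0) ->
    (forall t, t \in faces Y k -> \sum_s ratr (incidence s t) * phi s = 0) ->
    (forall r, r \in faces Y k.+2 ->
       \sum_(s in faces Y k.+1) ratr (incidence r s) * phi s = 0) ->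
    (forall t, t \in faces Y k -> forall x : 'I_N -> R,
       (forall v, x v != 0 -> (v \notin t) && (v |: t \in Y)) -> \sum_v x v = 0 ->
       \sum_u \sum_(v | (u != v) && (u |: (v |: t) \in Y)) x u * x v
       <= lam * \sum_v x v ^+ 2) ->
    (forall s, s \in faces Y k.+1 ->
       D <= #|[set v | (v \notin s) && (v |: s \in Y)]|%:R) ->
    k.+2%:R * lam < D ->
  forall s, phi s = 0.
Proof.
move=> supp cyc cocyc spec deg lamD.
have inc_neq0 s t : ratr (incidence s t) != 0 :> R -> exists2 v, v \notin t & s = v |: t.
  by rewrite fmorph_eq0; exact: incidence_neq0.
(* The localization of [phi] to the link of [t]; it is 0 on the vertices of [t] itself. *)
pose x t v := if v \notin t then ratr (incidence (v |: t) t) * phi (v |: t) else 0.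
have x_supp t v : x t v != 0 -> (v \notin t) && (v |: t \in faces Y k.+1).
  rewrite /x; case: ifP => [_|]; last by rewrite eqxx.
  rewrite mulf_eq0 negb_or => /andP[_ /=]; apply: contraNT => /supp ->; exact: eqxx.
have x_sum t : t \in faces Y k -> \sum_v x t v = 0.
  move=> /cyc; rewrite (sum_cofacets (t := t)); last first.
    by move=> s; rewrite mulf_eq0 negb_or => /andP[/inc_neq0].
  by rewrite -big_mkcond.
have x_sqr t v : v \notin t -> x t v ^+ 2 = phi (v |: t) ^+ 2.
  by move=> vt; rewrite /x vt exprMn -rmorphXn incidence_sqr // rmorph1 mul1r.
pose S := \sum_s phi s ^+ 2.
(* Membership in [Y] is an indicator factor, so that the sums run over all sets and
   [sum_setU1_setD1] applies. *)
pose Q := \sum_(t : {set 'I_N}) \sum_(v | v \notin t)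
  \sum_(u | u \notin v |: t) (u |: (v |: t) \in faces Y k.+2)%:R * (x t u * x t v).
have Q_le : Q <= k.+2%:R * lam * S.
  (* Each face [s] of [k.+2] vertices arises as [v |: t] from exactly [k.+2] pairs, whence the
     factor. *)
  have -> : k.+2%:R * lam * S = \sum_t lam * \sum_v x t v ^+ 2.
    rewrite -mulr_sumr mulrAC mulrC; congr (_ * _).
    transitivity (\sum_(t : {set 'I_N}) \sum_(v | v \notin t) phi (v |: t) ^+ 2); last first.
      apply: eq_bigr => t _; rewrite big_mkcond /=; apply: eq_bigr => v _.
      by case: ifP => [/x_sqr //|vt]; rewrite /x vt expr0n.
    rewrite sum_setU1_setD1 /S mulr_sumr; apply: eq_bigr => s _.
    transitivity (\sum_(v in s) phi s ^+ 2); last first.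
      by apply: eq_bigr => v vs; rewrite setD1K.
    rewrite sumr_const -[RHS]mulr_natl.
    have [sY|/supp ->] := boolP (s \in faces Y k.+1); last by rewrite expr0n /= !mulr0.
    by move: sY; rewrite !inE => /andP[_ /eqP ->].
  apply: ler_sum => t _; have [tY|tNY] := boolP (t \in faces Y k).
    apply: le_trans (spec t tY (x t) _ (x_sum t tY)); last first.
      by move=> v /x_supp; rewrite !inE => /andP[-> /andP[->]].
    rewrite le_eqVlt; apply/orP; left; apply/eqP.
    under [RHS]eq_bigr => u _ do rewrite big_mkcond.
    rewrite [RHS]exchange_big big_mkcond /=; apply: eq_bigr => v _.
    case: ifPn => [vt|/negPn vt]; last first.
      by rewrite big1 // => u _; rewrite /x vt mulr0 if_same.
    rewrite big_mkcond /=; apply: eq_bigr => u _.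
    rewrite !inE negb_or.
    case: eqVneq => [->|uv] //=.
    case: ifPn => [ut|/negPn ut]; last by rewrite /x ut mul0r if_same.
    have -> : #|u |: (v |: t)| == k.+3.
      rewrite !cardsU1 !inE negb_or uv ut vt /= !add1n.
      by move: tY; rewrite inE => /andP[_ /eqP ->].
    by rewrite andbT; case: ifP => _; rewrite ?mul1r ?mul0r.
  have x0 v : x t v = 0.
    apply/eqP; apply: contraNT tNY => /x_supp /andP[vt vtY].
    by rewrite -(setU1K vt) (faces_setD1 vtY) ?setU11.
  rewrite !big1 ?mulr0 //; first by move=> v _; rewrite x0 expr0n.
  by move=> v _; rewrite big1 // => u _; rewrite !x0 mulr0 mulr0.
have Q_ge : D * S <= Q.
  (* The terms of the coboundary of [phi] at [r]. For [r = u |: (v |: t)], [incidence_square] turns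
     [x t u * x t v] into [- (a r u * a r v)]. *)
  pose a r v : R := ratr (incidence r (r :\ v)) * phi (r :\ v).
  have -> : Q = \sum_(r : {set 'I_N}) \sum_(u in r) (r \in faces Y k.+2)%:R * phi (r :\ u) ^+ 2.
    transitivity (\sum_(s : {set 'I_N}) \sum_(v in s) \sum_(u | u \notin s)
       (u |: s \in faces Y k.+2)%:R * - (a (u |: s) u * a (u |: s) v)).
      rewrite /Q sum_setU1_setD1.
      apply: eq_bigr => s _; apply: eq_bigr => v vs; rewrite setD1K //.
      apply: eq_bigr => u us; congr (_ * _).
      have ut : u \notin s :\ v by rewrite inE (negPf us) andbF.
      have vt : v \notin s :\ v by rewrite setD11.
      have uv : u != v by apply: contraNneq us => ->.
      have E : (u |: s) :\ v = u |: (s :\ v).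
        by rewrite -{1}(setD1K vs) setUCA setU1K // !inE eq_sym (negPf uv) eqxx.
      have := incidence_square uv ut vt.
      rewrite setUCA !setD1K // => /(congr1 (fun z => ratr z : R)).
      rewrite rmorphN !rmorphM /x /a vt ut E setU1K // setD1K // => sq.
      by rewrite mulrACA sq; ring.
    transitivity (\sum_(r : {set 'I_N}) \sum_(u in r) \sum_(v in r :\ u)
       (r \in faces Y k.+2)%:R * - (a r u * a r v)).
      under eq_bigr => s _ do rewrite exchange_big.
      rewrite sum_setU1_setD1; apply: eq_bigr => r _; apply: eq_bigr => u ur.
      by rewrite setD1K.
    apply: eq_bigr => r _; have [rY|_] := boolP (r \in faces Y k.+2); last first.
      rewrite !big1 // => u _; first by rewrite mul0r.
      by rewrite big1 // => v _; rewrite mul0r.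
    have a_sum : \sum_(v in r) a r v = 0.
      rewrite -[RHS](cocyc r rY) (sum_facets rY) //.
      by move=> s; rewrite mulf_eq0 negb_or => /andP[/inc_neq0].
    apply: eq_bigr => u ur; under eq_bigr => v _ do rewrite mul1r.
    rewrite sumrN -mulr_sumr mul1r.
    (* The cocycle identity replaces the sum over [v != u] by the single term [- a r u], so the
       products become squares. *)
    have -> : \sum_(v in r :\ u) a r v = - a r u.
      apply/eqP; rewrite -addr_eq0 -[X in _ == X]a_sum (bigD1 u ur) /= addrC; apply/eqP; congr (_ + _).
      by apply: eq_bigl => v; rewrite !inE andbC.
    rewrite mulrN opprK -expr2 /a exprMn -rmorphXn -{1}(setD1K ur) incidence_sqr ?setD11 //.
    by rewrite rmorph1 mul1r.
  (* Regrouped by [s = r :\ u], each [phi s ^+ 2] is counted once per coface of [s], that is, with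
     its degree. *)
  have -> : \sum_(r : {set 'I_N}) \sum_(u in r)
      (r \in faces Y k.+2)%:R * phi (r :\ u) ^+ 2 =
    \sum_(s : {set 'I_N}) \sum_(u | u \notin s)
      (u |: s \in faces Y k.+2)%:R * phi s ^+ 2.
    rewrite sum_setU1_setD1; apply: eq_bigr => r _; apply: eq_bigr => u ur.
    by rewrite setD1K.
  rewrite /S mulr_sumr; apply: ler_sum => s _.
  have [sY|/supp ->] := boolP (s \in faces Y k.+1); last first.
    by rewrite big1 => [|u _]; rewrite expr0n /= !mulr0.
  rewrite -mulr_suml; apply: ler_wpM2r; first exact: sqr_ge0.
  apply: le_trans (deg s sY) _; rewrite -natr_sum ler_nat -sum1_card big_mkcond.
  rewrite [X in (_ <= X)%N]big_mkcond leq_sum //= => u _.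
  rewrite !inE; case: ifP => // /andP[us usY]; rewrite us usY cardsU1 us /=.
  by move: sY; rewrite inE => /andP[_ /eqP ->]; rewrite add1n eqxx.
have S_le0 : S <= 0.
  by rewrite leNgt; apply/negP => S_gt0; have := le_trans Q_ge Q_le; rewrite ler_pM2r // leNgt lamD.
move=> s; apply/eqP; rewrite -sqrf_eq0 eq_le sqr_ge0 andbT (le_trans _ S_le0) //.
by rewrite /S (bigD1 s) //= lerDl sumr_ge0 // => t _; exact: sqr_ge0.
Qed.

(** A dimension count. The kernels of [D0] and of [D1^T] meet trivially in a space of dimension
    [#|faces Y k.+1|], and the second has codimension [\rank D1]. Hence the kernel of [D0] has
    dimension at most [\rank D1], while it contains the image of [D1]. *)
Lemma homology_vanishes_harmonic k :
    (forall phi : 'rV[rat]_#|faces Y k.+1|,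
       phi *m bdry Y k.+1 = 0 -> phi *m (bdry Y k.+2)^T = 0 -> phi = 0) ->
  homology_vanishes Y k.+1.
Proof.
move=> harm; rewrite /homology_vanishes.
set D0 := bdry Y k.+1; set D1 : 'M_(_, #|faces Y k.+1|) := bdry Y k.+2.
have D1D0 : (D1 <= kermx D0)%MS by apply/sub_kermxP; exact: bdry_bdry.
rewrite -(geq_leqif (mxrank_leqif_sup D1D0)).
have cap0 : \rank (kermx D0 :&: kermx D1^T)%MS = 0%N.
  apply/eqP; rewrite mxrank_eq0; apply/eqP/row_matrixP => i; rewrite row0.
  have := row_sub i (kermx D0 :&: kermx D1^T)%MS; rewrite sub_capmx.
  by case/andP => /sub_kermxP ? /sub_kermxP ?; exact: harm.
have := mxrank_sum_cap (kermx D0) (kermx D1^T); rewrite cap0 addn0.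
have := rank_leq_col (kermx D0 + kermx D1^T)%MS.
rewrite [X in _ -> _ = (_ + X)%N -> _]mxrank_ker mxrank_tr.
have := rank_leq_col D1; lia.
Qed.

Lemma garland_homology (R : realFieldType) k (lam D : R) :
    (forall t, t \in faces Y k -> forall x : 'I_N -> R,
       (forall v, x v != 0 -> (v \notin t) && (v |: t \in Y)) -> \sum_v x v = 0 ->
       \sum_u \sum_(v | (u != v) && (u |: (v |: t) \in Y)) x u * x v
       <= lam * \sum_v x v ^+ 2) ->
    (forall s, s \in faces Y k.+1 ->
       D <= #|[set v | (v \notin s) && (v |: s \in Y)]|%:R) ->
    k.+2%:R * lam < D ->
  homology_vanishes Y k.+1.
Proof.
move=> spec deg lamD; apply: homology_vanishes_harmonic => phi phiD0 phiD1.
(* At most one index contributes: this is the extension of [phi] by 0 to all vertex sets, cast into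
   [R]. *)
pose f s : R := \sum_(i | enum_val i == s) ratr (phi 0 i).
have fE i : f (enum_val i) = ratr (phi 0 i).
  by rewrite /f (big_pred1 i) // => j /=; rewrite (inj_eq enum_val_inj).
have f0 s : s \notin faces Y k.+1 -> f s = 0.
  by move=> sNY; rewrite /f big1 // => i /eqP s_eq; rewrite -s_eq enum_valP in sNY.
suff f_eq0 : forall s, f s = 0.
  apply/rowP => i; rewrite mxE; have := f_eq0 (enum_val i); rewrite fE => /eqP.
  by rewrite fmorph_eq0 => /eqP.
apply: (garland f0 _ _ spec deg lamD) => [t tY|r rY].
  rewrite (bigID [pred s | s \in faces Y k.+1]) /= [X in _ + X]big1 ?addr0; last first.
    by move=> s /f0 ->; rewrite mulr0.
  rewrite big_enum_val /=.
  under eq_bigr => i _ do rewrite fE -rmorphM.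
  have /matrixP/(_ 0 (enum_rank_in tY t)) := phiD0; rewrite !mxE => phi0.
  rewrite -rmorph_sum -[RHS](rmorph0 (ratr : rat -> R)) -[in RHS]phi0; congr ratr.
  by apply: eq_bigr => i _; rewrite mxE enum_rankK_in // mulrC.
rewrite big_enum_val /=; under eq_bigr => i _ do rewrite fE -rmorphM.
have /matrixP/(_ 0 (enum_rank_in rY r)) := phiD1; rewrite !mxE => phi0.
rewrite -rmorph_sum -[RHS](rmorph0 (ratr : rat -> R)) -[in RHS]phi0; congr ratr.
by apply: eq_bigr => i _; rewrite !mxE enum_rankK_in // mulrC.
Qed.

End Garland.

(** * Quadratic forms and traces *)

Section QuadraticForm.
Variable F : realFieldType.

Lemma sum_sqr_ge0 (I : finType) (f : I -> F) : 0 <= \sum_i f i ^+ 2.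
Proof. by apply: sumr_ge0 => i _; exact: sqr_ge0. Qed.

Lemma cauchy_schwarz (I : finType) (f g : I -> F) :
  (\sum_i f i * g i) ^+ 2 <= (\sum_i f i ^+ 2) * (\sum_i g i ^+ 2).
Proof.
set a := \sum_i f i ^+ 2; set b := \sum_i f i * g i; set c := \sum_i g i ^+ 2.
have a_ge0 : 0 <= a := sum_sqr_ge0 f.
have key x y : 0 <= x ^+ 2 * a + 2 * x * y * b + y ^+ 2 * c.
  rewrite /a /b /c !mulr_sumr -!big_split /=; apply: sumr_ge0 => i _.
  by have := sqr_ge0 (x * f i + y * g i); nra.
have c_ge0 : 0 <= c := sum_sqr_ge0 g.
(* When [a = 0] the choice [x = - (c + 1)], [y = b] forces [b = 0]; otherwise the minimizing choice
   [x = - b], [y = a] works. *)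
have [a0|a_neq0] := eqVneq a 0.
  have := key (- (c + 1)) b; rewrite a0 => h.
  have := mulr_ge0 c_ge0 (sqr_ge0 b); rewrite !expr2 in h *; lra.
have a_gt0 : 0 < a by rewrite lt0r a_neq0.
rewrite -subr_ge0 -(pmulr_rge0 _ a_gt0).
have -> : a * (a * c - b ^+ 2) = (- b) ^+ 2 * a + 2 * (- b) * a * b + a ^+ 2 * c by ring.
exact: key.
Qed.

Variable n : nat.
Implicit Types (M : 'M[F]_n.+1) (x : 'rV[F]_n.+1).

Definition sqnorm x : F := \sum_i x 0 i ^+ 2.
Definition qform M x : F := (x *m M *m x^T) 0 0.

Lemma sqnorm_ge0 x : 0 <= sqnorm x. Proof. exact: sum_sqr_ge0. Qed.

Lemma qform_sqr M x : M^T = M -> qform (M ^+ 2) x = sqnorm (x *m M).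
Proof.
move=> Msym; rewrite /qform expr2 -[M * M]/(M *m M) mulmxA -mulmxA -{2}Msym -trmx_mul.
by rewrite [LHS]mxE; apply: eq_bigr => i _; rewrite [X in _ * X]mxE expr2.
Qed.

Lemma qform_le M x : qform M x ^+ 2 <= sqnorm x * sqnorm (x *m M).
Proof.
rewrite mulrC /qform mxE /sqnorm.
under eq_bigr => i _ do rewrite [X in _ * X]mxE.
exact: cauchy_schwarz.
Qed.

Lemma trmx_exp M k : M^T = M -> (M ^+ k)^T = M ^+ k.
Proof.
move=> Msym; elim: k => [|k IHk]; first by rewrite trmx1.
by rewrite exprSr -[LHS]/((M ^+ k *m M)^T) trmx_mul Msym IHk -[LHS]/(M * M ^+ k) -exprS exprSr.
Qed.

(** For a unit vector, Cauchy-Schwarz gives [qform A x ^+ 2 <= qform (A ^+ 2) x] for symmetric [A];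
    repeated squaring gives the rest without diagonalizing [M]. *)
Lemma qform_pow2 M x k : M^T = M ->
  qform M x ^+ (2 ^ k) * sqnorm x <= sqnorm x ^+ (2 ^ k) * qform (M ^+ (2 ^ k)) x.
Proof.
move=> Msym; elim: k => [|k IHk]; first by rewrite expn0 !expr1 mulrC.
have [x0|x_neq0] := eqVneq (sqnorm x) 0.
  by rewrite x0 mulr0 expr0n expn_eq0 /= mul0r.
have x_gt0 : 0 < sqnorm x by rewrite lt0r x_neq0 sqnorm_ge0.
have step : qform (M ^+ (2 ^ k)) x ^+ 2 <= sqnorm x * qform (M ^+ (2 ^ k.+1)) x.
  rewrite expnS mulnC exprM qform_sqr ?trmx_exp //; exact: qform_le.
rewrite -(ler_pM2r x_gt0) -mulrA -expr2.
(* At exponent 1 the left side of the induction hypothesis may be negative and cannot be squared, so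
   that case follows from [step] alone; later exponents are even. *)
case: k IHk step => [|k] IHk step.
  move: step; rewrite expn0 expn1 expr1 => step; rewrite !expr2 in step *.
  have := ler_wpM2l (ltW (exprn_gt0 2 x_gt0)) step; lra.
have pos : 0 <= qform M x ^+ (2 ^ k.+1) * sqnorm x.
  by rewrite mulr_ge0 ?(ltW x_gt0) // expnS exprM exprn_ge0 ?sqr_ge0.
have := @ler_pM _ _ _ _ _ pos pos IHk IHk; rewrite -!expr2 !exprMn -!exprM -!(mulnC 2%N) -!expnS.
move=> h; apply: le_trans h _.
rewrite -[leRHS]mulrA ler_wpM2l ?exprn_ge0 ?(ltW x_gt0) //.
by rewrite mulrC.
Qed.

(** For symmetric [M], the trace of [M ^+ 2] is the squared Frobenius norm. *)
Lemma sqnorm_mulmx_le M x : M^T = M -> sqnorm (x *m M) <= sqnorm x * \tr (M ^+ 2).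
Proof.
move=> Msym; rewrite /mxtrace expr2 mulr_sumr; apply: ler_sum => i _.
have -> : (M * M) i i = \sum_j M j i ^+ 2.
  by rewrite -{1}Msym mxE; apply: eq_bigr => j _; rewrite mxE expr2.
rewrite mxE; exact: cauchy_schwarz.
Qed.

Lemma mxtrace_even_ge0 M k : M^T = M -> 0 <= \tr (M ^+ (2 * k)).
Proof.
move=> Msym; rewrite mulnC exprM /mxtrace; apply: sumr_ge0 => i _.
rewrite expr2 -{1}(trmx_exp k Msym) mxE; apply: sumr_ge0 => j _.
by rewrite mxE -expr2 sqr_ge0.
Qed.

(** The trace of an even power dominates the same power of the largest eigenvalue: [qform_pow2]
    raises the form to the power [2 ^ k.+1], and the form of that power of [M] is a squared norm
    bounded by the trace. *)
Lemma qform_le_trace M x (lambda : F) k : M^T = M -> 0 <= lambda ->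
  \tr (M ^+ (2 ^ k.+1)) <= lambda ^+ (2 ^ k.+1) -> qform M x <= lambda * sqnorm x.
Proof.
move=> Msym l_ge0 trM; have [x0|x_neq0] := eqVneq (sqnorm x) 0.
  have := qform_le M x; rewrite x0 mul0r mulr0 => h.
  have : qform M x ^+ 2 == 0 by rewrite eq_le h sqr_ge0.
  by rewrite sqrf_eq0 => /eqP ->.
have x_gt0 : 0 < sqnorm x by rewrite lt0r x_neq0 sqnorm_ge0.
have [M_le0|M_gt0] := ltrP 0 (qform M x); last first.
  by apply: le_trans M_gt0 _; rewrite mulr_ge0 // ltW.
have K_gt0 : (0 < 2 ^ k.+1)%N by rewrite expn_gt0.
rewrite -(@ler_pXn2r _ (2 ^ k.+1)) ?nnegrE ?mulr_ge0 ?(ltW x_gt0) ?(ltW M_le0) //.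
rewrite -(ler_pM2r x_gt0); apply: le_trans (qform_pow2 x k.+1 Msym) _.
rewrite exprMn mulrAC [leRHS]mulrC ler_pM2l ?exprn_gt0 //.
rewrite {1}expnS mulnC exprM qform_sqr ?trmx_exp //.
apply: le_trans (sqnorm_mulmx_le _ _) _; first exact: trmx_exp.
by rewrite -exprM mulnC -expnS mulrC ler_wpM2r // sqnorm_ge0.
Qed.

End QuadraticForm.

(** * The random hypergraph *)

Section Expectation.
Variables (N : nat) (R : realFieldType) (ps : {set 'I_N} -> R).
Hypothesis ps_itv : forall s, s \in proper_faces N -> 0 <= ps s <= 1.

Definition expect (f : {set {set 'I_N}} -> R) : R :=
  \sum_X lower_weight ps X * f X.

Lemma lower_weight_ge0 X : 0 <= lower_weight ps X.
Proof.
rewrite /lower_weight; case: ifP => // _; apply: prodr_ge0 => s /ps_itv/andP[? ?].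
by case: ifP => // _; rewrite subr_ge0.
Qed.

Lemma expectZ a f : expect (fun X => a * f X) = a * expect f.
Proof. by rewrite /expect mulr_sumr; apply: eq_bigr => X _; rewrite mulrCA. Qed.

Lemma expectD f g : expect (fun X => f X + g X) = expect f + expect g.
Proof. by rewrite /expect -big_split; apply: eq_bigr => X _; rewrite mulrDr. Qed.

Lemma expect_sum (I : Type) (r : seq I) (P : pred I) (f : I -> {set {set 'I_N}} -> R) :
  expect (fun X => \sum_(i <- r | P i) f i X) = \sum_(i <- r | P i) expect (f i).
Proof.
rewrite /expect exchange_big /=; apply: eq_bigr => X _; exact: mulr_sumr.
Qed.

Lemma eq_expect f g : f =1 g -> expect f = expect g.
Proof. by move=> fg; apply: eq_bigr => X _; rewrite fg. Qed.

Lemma le_expect f g : (forall X, f X <= g X) -> expect f <= expect g.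
Proof. by move=> fg; apply: ler_sum => X _; rewrite ler_wpM2l ?lower_weight_ge0. Qed.

Lemma expect_subset (F : {set {set 'I_N}}) : F \subset proper_faces N ->
  expect (fun X => (F \subset X)%:R) = \prod_(s in F) ps s.
Proof.
move=> Fp.
(* [a] and [b] weigh the cases [s] in [X] and [s] outside [X], under the constraint that [F] lies in
   [X]. A set that is not a proper face is forced out of [X] by the weights 0 and 1. *)
pose a s := if s \in proper_faces N then ps s else 0.
pose b s := if s \in proper_faces N then (if s \in F then 0 else 1 - ps s) else 1.
transitivity (\prod_s (a s + b s)); last first.
  rewrite [RHS]big_mkcond /=; apply: eq_bigr => s _; rewrite /a /b.
  case: ifP => [sp|sNp]; last by rewrite add0r; case: ifP => // /(subsetP Fp); rewrite sNp.
  by case: ifP => _; rewrite ?addr0 // addrC subrK.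
rewrite bigA_distr /=; apply: eq_bigr => X _.
rewrite /lower_weight; case: ifP => [/subsetP Xp|/negbT/subsetPn[s sX sNp]]; last first.
  by rewrite mul0r (bigD1 s) //= sX /a (negPf sNp) mul0r.
case: (boolP (F \subset X)) => [/subsetP FX|/subsetPn[s sF sNX]]; last first.
  by rewrite mulr0 (bigD1 s) //= (negPf sNX) /b (subsetP Fp _ sF) sF mul0r.
rewrite mulr1 big_mkcond /=; apply: eq_bigr => s _; rewrite /a /b.
case: ifP => sp; last by case: ifP => // /Xp; rewrite sp.
by case: ifP => // sNX; case: ifP => // /FX; rewrite sNX.
Qed.

Lemma expect1 : expect (fun=> 1) = 1.
Proof.
have E0 : expect (fun X => (finset.set0 \subset X)%:R) = 1.
  by rewrite expect_subset ?finset.sub0set // finset.big_set0.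
by rewrite -[RHS]E0; apply: eq_expect => X; rewrite finset.sub0set.
Qed.

End Expectation.

Lemma lower_prob_expect (R : realFieldType) (n : nat) (ps : {set 'I_n.+1} -> R) E :
  lower_prob ps E = expect ps (fun X => (E (lowerY X))%:R).
Proof.
rewrite /lower_prob big_mkcond; apply: eq_bigr => X _.
by case: ifP => _; rewrite ?mulr1 ?mulr0.
Qed.

(** * Independence of the events that describe a link *)

Section Links.
Variables (N : nat) (t : {set 'I_N}).

(** For [t] in the complex and [z] a single vertex [v], these are the hyperedges that must be
    present for [v |: t] to be a face; for a pair, those needed beyond the two vertex conditions. *)
Definition joins (z : {set 'I_N}) : {set {set 'I_N}} := [set z :|: s | s in powerset t].

Definition joined (z : {set 'I_N}) (X : {set {set 'I_N}}) := joins z \subset X.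

Lemma joins_inj (Z : {set {set 'I_N}}) : (forall z, z \in Z -> [disjoint z & t]) ->
  {in setX Z (powerset t) &, injective (fun x : {set 'I_N} * {set 'I_N} => x.1 :|: x.2)}.
Proof.
move=> Zt [z1 s1] [z2 s2]; rewrite !inE /= => /andP[/Zt z1t s1t] /andP[/Zt z2t s2t] eqU.
have /setP := eqU; rewrite -setI_eq0 in z1t; rewrite -setI_eq0 in z2t => eqw.
congr (_, _); apply/setP => w; have := eqw w; rewrite !inE.
all: have /setP/(_ w) := eqP z1t; have /setP/(_ w) := eqP z2t; rewrite !inE.
all: have := subsetP s1t w; have := subsetP s2t w.
all: case: (w \in t); case: (w \in z1); case: (w \in z2); case: (w \in s1); case: (w \in s2) => //=.
all: by move=> h1 h2; first [have := h1 isT | have := h2 isT].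
Qed.

Variables (R : realFieldType) (ps : {set 'I_N} -> R) (g : nat -> R).
Hypothesis ps_itv : forall s, s \in proper_faces N -> 0 <= ps s <= 1.
Hypothesis ps_card : forall s, s \in proper_faces N -> ps s = g #|s|.

(** By [joins_inj], different [z] involve disjoint families of hyperedges, so the events are
    independent. The size condition keeps every hyperedge involved different from the full vertex
    set. *)
Lemma expect_joined (Z : {set {set 'I_N}}) :
    (forall z, z \in Z -> [&& z != finset.set0, [disjoint z & t] & (#|z| + #|t| < N)%N]) ->
  expect ps (fun X => \prod_(z in Z) (joined z X)%:R) =
  \prod_(z in Z) \prod_(s in powerset t) g (#|z| + #|s|).
Proof.
move=> Zt; set F := \bigcup_(z in Z) joins z.
have Zdisj z : z \in Z -> [disjoint z & t] by move=> /Zt/and3P[].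
have FE : F = [set x.1 :|: x.2 | x in setX Z (powerset t)].
  apply/setP => s; apply/bigcupP/imsetP => [[z zZ /imsetP[u ut ->]]|[[z u]]].
    by exists (z, u) => //; rewrite inE /= zZ.
  by rewrite inE /= => /andP[zZ ut] ->; exists z => //; apply/imsetP; exists u.
have szU z u : z \in Z -> u \in powerset t -> #|z :|: u| = (#|z| + #|u|)%N.
  move=> /Zdisj zt; rewrite inE => ut; apply/eqP; rewrite (leq_card_setU z u).2.
  by rewrite disjoint_sym (disjointWl ut) // disjoint_sym.
have proper z u : z \in Z -> u \in powerset t -> z :|: u \in proper_faces N.
  move=> zZ ut; have := szU z u zZ ut; have /and3P[z0 _ sz] := Zt z zZ.
  move=> szzu; rewrite inE -card_gt0 szzu addn_gt0 card_gt0 z0 /=.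
  apply: contraTneq sz => zu; rewrite -leqNgt -[N in (N <= _)%N]card_ord -cardsT -zu szzu.
  by rewrite leq_add2l subset_leq_card // -powersetE.
have Fp : F \subset proper_faces N.
  apply/subsetP => s; rewrite FE => /imsetP[[z u]]; rewrite inE /= => /andP[zZ ut] ->.
  exact: proper.
transitivity (expect ps (fun X => (F \subset X)%:R)).
  apply: eq_expect => X; rewrite -natr_prod; congr _%:R.
  apply/esym; case: (boolP (F \subset X)) => [/bigcupsP FX|].
    by rewrite big1 // => z zZ; rewrite /joined FX.
  move=> FNX; apply/esym/eqP; rewrite eqn0Ngt; apply: contraNN FNX => prod_gt0.
  apply/bigcupsP => z zZ; move: prod_gt0; rewrite (bigD1 z) //= muln_gt0 lt0b.
  by case/andP.
rewrite expect_subset // FE big_imset /=; last exact: joins_inj.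
rewrite pair_big_dep /=; apply: eq_big => [[z u]|[z u]]; rewrite inE //= => /andP[zZ ut].
by rewrite ps_card ?proper // szU.
Qed.

End Links.

(** * Walks and trace moments *)

Section Walks.
Variables (R : realFieldType) (T : finType).
Implicit Types (x y : T) (s : seq T).

Fixpoint seqsum k (F : seq T -> R) : R :=
  if k is k'.+1 then \sum_x seqsum k' (fun s => F (x :: s)) else F [::].

Lemma eq_seqsum k F G : F =1 G -> seqsum k F = seqsum k G.
Proof.
elim: k F G => [|k IHk] F G FG //=; apply: eq_bigr => x _.
by apply: IHk => s; rewrite FG.
Qed.

Lemma le_seqsum k F G : (forall s, size s = k -> F s <= G s) ->
  seqsum k F <= seqsum k G.
Proof.
elim: k F G => [|k IHk] F G FG /=; first exact: FG.
by apply: ler_sum => x _; apply: IHk => s sz; apply: FG; rewrite /= sz.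
Qed.

Lemma seqsumZ k a F : seqsum k (fun s => a * F s) = a * seqsum k F.
Proof.
elim: k F => [|k IHk] F //=; rewrite mulr_sumr; apply: eq_bigr => x _.
exact: (IHk (fun s => F (x :: s))).
Qed.

Lemma seqsum_cons k (F : T -> seq T -> R) :
  \sum_x seqsum k (F x) = seqsum k (fun s => \sum_x F x s).
Proof.
elim: k F => [|k IHk] F //=; rewrite exchange_big /=; apply: eq_bigr => y _.
exact: (IHk (fun x s => F x (y :: s))).
Qed.

(** A vertex put in front of a sequence of length [k] either repeats one of at most [k] vertices, or
    is new at total cost [#|T|%:R * r <= 2]; each step thus costs a factor at most [k.+2%:R]. *)
Lemma seqsum_undup k (r : R) : 0 <= r -> #|T|%:R * r <= 2 ->
  seqsum k (fun s => r ^+ size (undup s)) <= k.+1%:R ^+ k.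
Proof.
move=> r0 rT; elim: k => [|k IHk]; first by rewrite /= !expr0.
rewrite /= (seqsum_cons k (fun x s => r ^+ size (undup (x :: s)))).
have step s : size s = k ->
    \sum_x r ^+ size (undup (x :: s)) <= k.+2%:R * r ^+ size (undup s).
  move=> sz; rewrite (bigID [in s]) /=.
  rewrite (eq_bigr (fun=> r ^+ size (undup s))); last by move=> x ->.
  rewrite [X in _ + X](eq_bigr (fun=> r * r ^+ size (undup s))); last first.
    by move=> x /negPf ->; rewrite exprS.
  rewrite !sumr_const -[X in X + _]mulr_natl -[X in _ + X]mulr_natl [X in _ + X]mulrA -mulrDl.
  rewrite ler_wpM2r ?exprn_ge0 // -addn2 natrD lerD //.
    by rewrite ler_nat -sz card_size.
  by apply: le_trans rT; rewrite ler_wpM2r // ler_nat max_card.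
apply: le_trans (le_seqsum step) _; rewrite seqsumZ exprS ler_wpM2l //.
by apply: le_trans IHk _; rewrite lerXn2r ?nnegrE ?ler0n // ler_nat.
Qed.

Fixpoint walk_weight (M : T -> T -> R) x s : R :=
  if s is y :: s' then M x y * walk_weight M y s' else 1.

Fixpoint walk_edges x s : seq {set T} :=
  if s is y :: s' then [set x; y] :: walk_edges y s' else [::].

(* The edges along which the walk, read backwards, meets a new vertex. *)
Fixpoint tree_edges x s : seq {set T} :=
  if s is y :: s' then
    if x \in s then tree_edges y s' else [set x; y] :: tree_edges y s'
  else [::].

Lemma size_walk_edges x s : size (walk_edges x s) = size s.
Proof. by elim: s x => //= y s IHs x; rewrite IHs. Qed.

Lemma walk_edges_sub x s e : e \in walk_edges x s -> {subset e <= x :: s}.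
Proof.
elim: s x => //= y s IHs x; rewrite inE => /orP[/eqP -> v|/IHs es v /es ys].
  by rewrite !inE orbA => ->.
by rewrite inE ys orbT.
Qed.

Lemma tree_edges_sub x s : {subset tree_edges x s <= walk_edges x s}.
Proof.
elim: s x => //= y s IHs x e; case: ifP => _.
  by move=> /IHs es; rewrite inE es orbT.
by rewrite !inE => /orP[->//|/IHs ->]; rewrite orbT.
Qed.

(** The edge recorded at a new vertex [x] contains [x], whereas the edges of the rest of the walk
    avoid it. *)
Lemma tree_edges_uniq x s : uniq (tree_edges x s).
Proof.
elim: s x => //= y s IHs x; case: ifP => //= xs; rewrite IHs andbT.
apply/negP => /tree_edges_sub/walk_edges_sub/(_ x).
by rewrite xs set21 => /(_ isT).
Qed.

Lemma size_tree_edges x s : (size (tree_edges x s)).+1 = size (undup (x :: s)).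
Proof.
elim: s x => // y s IHs x.
have -> : tree_edges x (y :: s) =
  if x \in y :: s then tree_edges y s else [set x; y] :: tree_edges y s by [].
have -> : undup (x :: y :: s) =
  if x \in y :: s then undup (y :: s) else x :: undup (y :: s) by [].
by case: ifP => _; [exact: IHs | rewrite -[RHS]/((size (undup (y :: s))).+1) -IHs].
Qed.

(** Each element of [r] claims two positions of [s]; the induction filters out all occurrences of
    one element. *)
Lemma double_size_le (S : eqType) (r s : seq S) : uniq r ->
  (forall e, e \in r -> (2 <= count_mem e s)%N) -> ((size r).*2 <= size s)%N.
Proof.
elim: r s => //= e r IHr s /andP[er ur] rs.
rewrite doubleS -(count_predC (pred1 e) s) -addn2 addnC leq_add ?rs ?mem_head //.
rewrite -size_filter IHr // => f fr; rewrite count_filter.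
rewrite (leq_trans (rs f _)) ?inE ?fr ?orbT // sub_count // => g /= /eqP ->.
by rewrite eqxx /=; apply: contraNneq er => <-.
Qed.
End Walks.

Lemma mxexp_walks (R : realFieldType) n (M : 'M[R]_n.+1) k u v :
  (M ^+ k) u v = seqsum k (fun s => (last u s == v)%:R * walk_weight (fun x y => M x y) u s).
Proof.
elim: k u => [|k IHk] u /=; first by rewrite expr0 !mxE mulr1.
rewrite exprS mxE; apply: eq_bigr => y _; rewrite IHk -seqsumZ.
by apply: eq_seqsum => s; rewrite /= mulrCA.
Qed.

Lemma prod_seq_le (R : realFieldType) (I : eqType) (r s : seq I) (f g : I -> R) :
    uniq r -> {subset r <= s} ->
    (forall i, 0 <= f i <= 1) -> (forall i, f i <= g i) ->
  \prod_(i <- s) f i <= \prod_(i <- r) g i.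
Proof.
move=> r_uniq rs f01 fg; have f0 i : 0 <= f i by case/andP: (f01 i).
elim: r s r_uniq rs => [|i r IHr] s /=.
  move=> _ _; rewrite big_nil.
  suff /andP[] : 0 <= \prod_(i <- s) f i <= 1 by [].
  apply: (big_ind (fun x => 0 <= x <= 1)); rewrite ?ler01 ?lexx // => x y.
  by move=> /andP[? ?] /andP[? ?]; rewrite mulr_ge0 ?mulr_ile1.
move=> /andP[ir r_uniq] rs; have iS : i \in s by rewrite rs ?mem_head.
rewrite (perm_big _ (perm_to_rem iS)) !big_cons ler_pM ?prodr_ge0 //.
apply: IHr => // j jr; have ji : j != i by apply: contraNneq ir => <-.
have := rs j; rewrite inE jr orbT => /(_ isT).
by rewrite (perm_mem (perm_to_rem iS)) inE (negPf ji).
Qed.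

(** * Moments of the centered link matrix and of the degree *)

Section Moments.
Variables (n : nat) (R : realFieldType) (ps : {set 'I_n.+1} -> R).
Hypothesis ps_itv : forall s, s \in proper_faces n.+1 -> 0 <= ps s <= 1.
Notation V := 'I_n.+1.
Notation event := ({set {set V}} -> bool).
Variables (t : {set V}) (c : {set V} -> event) (q : nat -> R).
Hypothesis q_itv : forall i, 0 <= q i <= 1.
Hypothesis expect_c : forall Z : {set {set V}},
  (forall z, z \in Z -> [disjoint z & t] && (0 < #|z| <= 2)%N) ->
  expect ps (fun X => \prod_(z in Z) (c z X)%:R) = \prod_(z in Z) q #|z|.

Implicit Types (X : {set {set V}}) (A : {set V}) (T : {set {set V}}) (L : seq {set V}).

Definition vmon A X : R := \prod_(v in A) (c [set v] X)%:R.
Definition emon T X : R := \prod_(e in T) (c e X)%:R.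

Definition link_edge (e : {set V}) := [disjoint e & t] && (#|e| == 2%N).

Lemma expect_mon A T : [disjoint A & t] -> (forall e, e \in T -> link_edge e) ->
  expect ps (fun X => vmon A X * emon T X) = q 1 ^+ #|A| * q 2 ^+ #|T|.
Proof.
move=> At Tt; pose S := [set [set v] | v in A].
have S1 z : z \in S -> [disjoint z & t] && (#|z| == 1%N).
  case/imsetP => v vA ->; rewrite cards1 eqxx andbT disjoints1.
  by have /pred0P/(_ v) := At; rewrite /= vA /= => ->.
have ST : [disjoint S & T].
  apply/pred0P => z; apply/negP => /= /andP[/S1/andP[_ /eqP z1] /Tt/andP[_]].
  by rewrite z1.
have prodST (F : {set V} -> R) :
    \prod_(z in S :|: T) F z = \prod_(z in S) F z * \prod_(z in T) F z.
  by rewrite -bigU //=; apply: eq_bigl => z; rewrite !inE.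
transitivity (expect ps (fun X => \prod_(z in S :|: T) (c z X)%:R)).
  apply: eq_expect => X; rewrite prodST; congr (_ * _).
  by rewrite big_imset //= => u v _ _ /set1_inj.
rewrite expect_c => [|z]; last first.
  by rewrite inE => /orP[/S1/andP[-> /eqP ->]|/Tt/andP[-> /eqP ->]].
rewrite prodST; congr (_ * _).
  rewrite big_imset /=; last by move=> u v _ _ /set1_inj.
  by under eq_bigr => v _ do rewrite cards1; rewrite prodr_const.
by rewrite -prodr_const; apply: eq_bigr => e /Tt/andP[_ /eqP ->].
Qed.

Lemma emonU1 T e X : emon (e |: T) X = (c e X)%:R * emon T X.
Proof.
rewrite /emon; case: (boolP (e \in T)) => eT; last by rewrite big_setU1.
rewrite (setUidPr _) ?sub1set // (bigD1 e) //= mulrA -natrM mulnb andbb.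
by [].
Qed.

Lemma vmonU1 A v X : vmon (v |: A) X = (c [set v] X)%:R * vmon A X.
Proof.
rewrite /vmon; case: (boolP (v \in A)) => vA; last by rewrite big_setU1.
rewrite (setUidPr _) ?sub1set // (bigD1 v) //= mulrA -natrM mulnb andbb.
by [].
Qed.

(** Multiplying out a factor either moves its edge into [T] or leaves the constant [a], which is why
    [T] is general in the induction. *)
Lemma expect_fresh A T L a : [disjoint A & t] ->
    (forall e, e \in T -> link_edge e) -> {in L, forall e, link_edge e} ->
    uniq L -> {in L, forall e, e \notin T} ->
  expect ps (fun X => vmon A X * emon T X * \prod_(e <- L) ((c e X)%:R + a)) =
  q 1 ^+ #|A| * q 2 ^+ #|T| * (q 2 + a) ^+ size L.
Proof.
move=> At; elim: L T => [|e L IHL] T Tt Lt /=.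
  move=> _ _; rewrite expr0 mulr1 -(expect_mon At Tt).
  by apply: eq_expect => X; rewrite big_nil mulr1.
case/andP => eL uL LT.
have eT : e \notin T by apply: LT; rewrite mem_head.
have Lt' : {in L, forall f, link_edge f} by move=> f fL; apply: Lt; rewrite inE fL orbT.
have LT' : {in L, forall f, f \notin T} by move=> f fL; apply: LT; rewrite inE fL orbT.
transitivity (expect ps (fun X =>
   vmon A X * emon (e |: T) X * \prod_(f <- L) ((c f X)%:R + a) +
   a * (vmon A X * emon T X * \prod_(f <- L) ((c f X)%:R + a)))).
  by apply: eq_expect => X; rewrite big_cons emonU1; ring.
have Te f : f \in e |: T -> link_edge f.
  by rewrite !inE => /orP[/eqP -> |/Tt //]; apply: Lt; rewrite mem_head.
have LTe : {in L, forall f, f \notin e |: T}.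
  move=> f fL; rewrite !inE negb_or LT' // andbT.
  by apply: contraNneq eL => <-.
rewrite expectD expectZ (IHL _ Te Lt' uL LTe) (IHL _ Tt Lt' uL LT').
have -> : #|e |: T| = #|T|.+1 by rewrite cardsU1 eT.
rewrite [q 2 ^+ _.+1]exprS [(_ + _) ^+ _.+1]exprS.
move: (q 2) => z; move: (q 1 ^+ _) (z ^+ #|_|) (_ ^+ size L) => x y B; ring.
Qed.

(** Expanding the factors of [L], which may repeat, only adds to [T] edges other than [e0]. The
    factor of [e0] stays independent of the rest and has mean 0. *)
Lemma expect_once A T L e0 : [disjoint A & t] ->
    (forall e, e \in T -> link_edge e) -> {in L, forall e, link_edge e} ->
    link_edge e0 -> e0 \notin T -> e0 \notin L ->
  expect ps (fun X => vmon A X * emon T X * ((c e0 X)%:R - q 2) *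
    \prod_(e <- L) ((c e X)%:R - q 2)) = 0.
Proof.
move=> At; elim: L T => [|e L IHL] T Tt Lt e0t e0T /=.
  move=> _; have := @expect_fresh A T [:: e0] (- q 2) At Tt.
  rewrite /= expr1 subrr mulr0 => <- //.
  - by apply: eq_expect => X; rewrite big_nil big_seq1 mulr1.
  - by move=> f; rewrite inE => /eqP ->.
  - by move=> f; rewrite inE => /eqP ->.
rewrite inE negb_or => /andP[e0e e0L].
have Lt' : {in L, forall f, link_edge f} by move=> f fL; apply: Lt; rewrite inE fL orbT.
transitivity (expect ps (fun X =>
   vmon A X * emon (e |: T) X * ((c e0 X)%:R - q 2) * \prod_(f <- L) ((c f X)%:R - q 2) +
   - q 2 * (vmon A X * emon T X * ((c e0 X)%:R - q 2) * \prod_(f <- L) ((c f X)%:R - q 2)))).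
  by apply: eq_expect => X; rewrite big_cons emonU1; ring.
have Te f : f \in e |: T -> link_edge f.
  by rewrite !inE => /orP[/eqP -> |/Tt //]; apply: Lt; rewrite mem_head.
have e0eT : e0 \notin e |: T by rewrite !inE negb_or e0e.
by rewrite expectD expectZ (IHL _ Te Lt' e0t e0eT e0L) (IHL _ Tt Lt' e0t e0T e0L) mulr0 addr0.
Qed.

(* The link graph of t, with each edge indicator centered at its mean [q 2]. *)
Definition link_mx X : 'M[R]_n.+1 := \matrix_(u, v)
  if [&& u != v, u \notin t & v \notin t] then
    (c [set u] X)%:R * (c [set v] X)%:R * ((c [set u; v] X)%:R - q 2)
  else 0.

Lemma link_mx_sym X : (link_mx X)^T = link_mx X.
Proof.
apply/matrixP => u v; rewrite !mxE eq_sym finset.setUC [X in _ && X]andbC.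
by rewrite [_%:R * _%:R]mulrC.
Qed.

Notation walk X := (walk_weight (fun u v => link_mx X u v)).

Definition proper_walk u (s : seq V) :=
  path [rel x y | x != y] u s && all [pred v | v \notin t] (u :: s).

Lemma walk_eq0 X u v s : ~~ proper_walk u (v :: s) -> walk X u (v :: s) = 0.
Proof.
elim: s u v => [|w s IHs] u v.
  rewrite /proper_walk /= !andbT => h.
  by rewrite mxE (negPf h) mul0r.
move=> h; have [vP|/IHs vP] := boolP (proper_walk v (w :: s)); last first.
  by rewrite -[LHS]/(link_mx X u v * walk X v (w :: s)) vP mulr0.
rewrite /= mxE ifN ?mul0r //; apply: contra h.
case/and3P => uv ut vt; move: vP; rewrite /proper_walk /= uv ut vt /=.
by [].
Qed.

(** Indicators are idempotent, so the vertex factors of consecutive entries merge into one per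
    distinct vertex. The extra factor at [u] covers the empty walk. *)
Lemma walkE X u s : proper_walk u s ->
  (c [set u] X)%:R * walk X u s =
  vmon [set v in u :: s] X * \prod_(e <- walk_edges u s) ((c e X)%:R - q 2).
Proof.
elim: s u => [|v s IHs] u /=.
  by move=> _; rewrite big_nil mulr1 mulr1 set_seq1 /vmon big_set1.
move=> /andP[/= /andP[uv vs] /and3P[ut vt st]].
have /IHs IH : proper_walk v s by rewrite /proper_walk vs /= vt st.
have -> : [set w in u :: v :: s] = u |: [set w in v :: s].
  by apply/setP => w; rewrite !inE.
rewrite big_cons mxE uv ut vt vmonU1 /=.
have cc : (c [set u] X)%:R * (c [set u] X)%:R = (c [set u] X)%:R :> R.
  by rewrite -natrM mulnb andbb.
transitivity (((c [set u] X)%:R * (c [set u] X)%:R) * ((c [set u; v] X)%:R - q 2) *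
   ((c [set v] X)%:R * walk X v s)); first by ring.
by rewrite cc IH; ring.
Qed.

Lemma walk_consE X u v s : proper_walk u (v :: s) ->
  walk X u (v :: s) = vmon [set w in u :: v :: s] X *
    \prod_(e <- walk_edges u (v :: s)) ((c e X)%:R - q 2).
Proof.
move=> uvs; rewrite -walkE //= mulrA; congr (_ * _).
rewrite mxE; case: ifP => _; last by rewrite mulr0.
have cc : (c [set u] X)%:R * (c [set u] X)%:R = (c [set u] X)%:R :> R.
  by rewrite -natrM mulnb andbb.
by rewrite !mulrA cc.
Qed.

Lemma proper_walk_disjoint u s : proper_walk u s -> [disjoint [set w in u :: s] & t].
Proof.
case/andP => _ /allP ust; apply/pred0P => w; apply/negP => /= /andP[].
by rewrite inE => /ust /= /negP.
Qed.

Lemma proper_walk_edges u s : proper_walk u s -> {in walk_edges u s, forall e, link_edge e}.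
Proof.
elim: s u => //= v s IHs u /andP[/= /andP[uv vs] /and3P[ut vt st]] e.
rewrite inE => /orP[/eqP ->|]; last by apply: IHs; rewrite /proper_walk vs /= vt st.
rewrite /link_edge cards2 uv eqxx andbT; apply/pred0P => w; apply/negP.
by rewrite /= !inE => /andP[/orP[]/eqP->]; rewrite ?(negPf ut) ?(negPf vt).
Qed.

Lemma expect_walk_once u v s e0 : proper_walk u (v :: s) ->
  count_mem e0 (walk_edges u (v :: s)) = 1%N -> expect ps (fun X => walk X u (v :: s)) = 0.
Proof.
move=> uvs; set W := walk_edges _ _ => e0W.
have e0inW : e0 \in W by rewrite -has_pred1 has_count e0W.
have perm_W := perm_to_rem e0inW.
have e0rem : e0 \notin rem e0 W.
  have := permP perm_W (pred1 e0); rewrite e0W /= eqxx => -[] /esym/eqP.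
  by rewrite -leqn0 leqNgt -has_count has_pred1.
have W_edge := proper_walk_edges uvs.
rewrite -[RHS](@expect_once [set w in u :: v :: s] finset.set0 (rem e0 W) e0) ?inE //.
- apply: eq_expect => X; rewrite walk_consE // (perm_big _ perm_W) big_cons.
  by rewrite /emon finset.big_set0 /=; ring.
- exact: proper_walk_disjoint.
- by move=> e; rewrite inE.
- by move=> e /mem_rem; exact: W_edge.
- exact: W_edge.
Qed.

Lemma vmon_ge0 A X : 0 <= vmon A X.
Proof. by apply: prodr_ge0 => v _; exact: ler0n. Qed.

(** A centered indicator has absolute value at most 1, and at most [(c e X)%:R + q 2]. The second
    bound is used on the tree edges, which are distinct and contribute [2 * q 2] each, and the first
    on all other steps. *)
Lemma expect_walk_le u v s : proper_walk u (v :: s) ->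
  expect ps (fun X => walk X u (v :: s)) <=
  q 1 ^+ size (undup (u :: v :: s)) * (2 * q 2) ^+ (size (undup (u :: v :: s))).-1.
Proof.
move=> uvs; set W := walk_edges u (v :: s); set Tr := tree_edges u (v :: s).
have -> : q 1 ^+ size (undup (u :: v :: s)) * (2 * q 2) ^+ (size (undup (u :: v :: s))).-1 =
  expect ps (fun X => vmon [set w in u :: v :: s] X * emon finset.set0 X *
    \prod_(e <- Tr) ((c e X)%:R + q 2)).
  rewrite expect_fresh ?tree_edges_uniq ?proper_walk_disjoint //.
  - have -> : size Tr = (size (undup (u :: v :: s))).-1 by rewrite -size_tree_edges.
    rewrite cards0 expr0 mulr1 -mulr2n -[X in _ = _ * X ^+ _]mulr_natl; congr (_ ^+ _ * _).
    rewrite -(card_uniqP (undup_uniq _)).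
    by apply: eq_card => w; rewrite finset.in_set mem_undup.
  - by move=> e; rewrite inE.
  - by move=> e /tree_edges_sub; exact: proper_walk_edges.
  - by move=> e; rewrite inE.
apply: le_expect => // X; rewrite walk_consE // /emon finset.big_set0 mulr1.
apply: ler_wpM2l; first exact: vmon_ge0.
have /andP[q0 q1] := q_itv 2.
have abs_le e : `|(c e X)%:R - q 2| <= 1 /\ `|(c e X)%:R - q 2| <= (c e X)%:R + q 2 :> R.
  by rewrite !ler_norml; case: (c e X) => /=; rewrite ?mulr1n ?mulr0n; split; apply/andP; split; lra.
apply: le_trans (ler_norm _) _; rewrite normr_prod; apply: prod_seq_le.
- exact: tree_edges_uniq.
- exact: tree_edges_sub.
- by move=> e; case: (abs_le e) => -> ?; rewrite normr_ge0.
- by move=> e; case: (abs_le e).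
Qed.

Lemma expect_eq0 (f : {set {set V}} -> R) : (forall X, f X = 0) -> expect ps f = 0.
Proof. by move=> f0; rewrite /expect big1 // => X _; rewrite f0 mulr0. Qed.

Lemma expect_seqsum k (F : {set {set V}} -> seq V -> R) :
  expect ps (fun X => seqsum k (F X)) = seqsum k (fun s => expect ps (fun X => F X s)).
Proof.
elim: k F => [|k IHk] F //=; rewrite expect_sum; apply: eq_bigr => x _.
exact: (IHk (fun X s => F X (x :: s))).
Qed.

Let d : R := n.+1%:R * (q 1 * q 2).

(** If no edge is used exactly once, the [h.*2] steps contain each tree edge at least twice, so
    there are at most [h] tree edges. Each of them contributes
    [q 1 * (2 * q 2) = d * (2 / n.+1%:R)], and [1 <= d] raises the power of [d] to [h]. *)
Lemma expect_closed_walk h u s : size s = h.*2 -> (0 < h)%N -> 1 <= d ->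
  expect ps (fun X => (last u s == u)%:R * walk X u s) <=
  q 1 * d ^+ h * (2 / n.+1%:R) ^+ (size (undup (u :: s))).-1.
Proof.
move=> sz h_gt0 d_ge1; rewrite expectZ.
have /andP[q1_ge0 _] := q_itv 1; have /andP[q2_ge0 _] := q_itv 2.
have d_ge0 : 0 <= d by apply: le_trans d_ge1.
set b := _ * _ * _; have b_ge0 : 0 <= b.
  by rewrite /b !mulr_ge0 ?exprn_ge0 ?divr_ge0 ?ler0n.
suff E_le : expect ps (fun X => walk X u s) <= b.
  by case: (_ == u); rewrite ?mul1r ?mul0r.
case: s sz @b b_ge0 => [|v s] sz b b_ge0; first by move: h_gt0; rewrite -double_gt0 -sz.
have [uvs|uvsN] := boolP (proper_walk u (v :: s)); last first.
  by rewrite expect_eq0 // => X; exact: walk_eq0.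
have [/existsP[e /eqP e1]|/existsPn noonce] :=
    boolP [exists e, count_mem e (walk_edges u (v :: s)) == 1%N].
  by rewrite (expect_walk_once uvs e1).
apply: le_trans (expect_walk_le uvs) _.
have Tr_le : ((size (undup (u :: v :: s))).-1 <= h)%N.
  rewrite -size_tree_edges succnK -leq_double -sz -(size_walk_edges u (v :: s)).
  apply: double_size_le (tree_edges_uniq _ _) _ => e /tree_edges_sub eW.
  by rewrite ltn_neqAle eq_sym noonce -has_count has_pred1.
have m_gt0 : (0 < size (undup (u :: v :: s)))%N by rewrite -size_tree_edges.
rewrite /b; case: (size _) m_gt0 Tr_le => // m _ /= m_le.
rewrite exprS -mulrA -[leRHS]mulrA ler_wpM2l // -exprMn.
have -> : q 1 * (2 * q 2) = d * (2 / n.+1%:R).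
  have : (n.+1%:R : R) != 0 by rewrite pnatr_eq0.
  by rewrite /d; move: (n.+1%:R : R) => y y0; field.
by rewrite exprMn ler_wpM2r ?exprn_ge0 ?divr_ge0 ?ler0n // ler_weXn2l.
Qed.

Lemma expect_trace h : (0 < h)%N -> 1 <= d ->
  expect ps (fun X => \tr (link_mx X ^+ h.*2)) <=
  n.+1%:R * h.*2.+2%:R ^+ h.*2.+1 * d ^+ h.
Proof.
move=> h_gt0 d_ge1.
have /andP[q1_ge0 q1_le1] := q_itv 1.
have N_gt0 : 0 < n.+1%:R :> R by rewrite ltr0n.
have r_ge0 : 0 <= 2 / n.+1%:R :> R by rewrite divr_ge0 ?ler0n.
have dh_ge0 : 0 <= d ^+ h by rewrite exprn_ge0 // (le_trans _ d_ge1).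
have -> : expect ps (fun X => \tr (link_mx X ^+ h.*2)) =
    \sum_u seqsum h.*2 (fun s => expect ps (fun X => (last u s == u)%:R * walk X u s)).
  rewrite /mxtrace expect_sum; apply: eq_bigr => u _.
  rewrite -expect_seqsum; apply: eq_expect => X; exact: mxexp_walks.
have -> : n.+1%:R * h.*2.+2%:R ^+ h.*2.+1 * d ^+ h =
  d ^+ h * n.+1%:R * h.*2.+2%:R ^+ h.*2.+1 by rewrite mulrC mulrA.
(* The bounds [q 1 <= 1] and [1 <= n.+1%:R * (2 / n.+1%:R)] supply the missing factor [2 / n.+1%:R],
   so that the exponent counts all distinct vertices. *)
apply: (@le_trans _ _ (\sum_u seqsum h.*2 (fun s => d ^+ h * n.+1%:R *
    (2 / n.+1%:R) ^+ size (undup (u :: s))))).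
  apply: ler_sum => u _; apply: le_seqsum => s sz.
  apply: le_trans (expect_closed_walk _ sz h_gt0 d_ge1) _.
  rewrite -mulrA mulrCA -mulrA ler_wpM2l //.
  have m_gt0 : (0 < size (undup (u :: s)))%N by rewrite -size_tree_edges.
  case: (size _) m_gt0 => // m _; rewrite exprS mulrA ler_wpM2r ?exprn_ge0 //.
  rewrite mulrC divfK ?gt_eqF //; lra.
rewrite (eq_bigr (fun u => d ^+ h * n.+1%:R * seqsum h.*2 (fun s =>
    (2 / n.+1%:R) ^+ size (undup (u :: s))))); last first.
  by move=> u _; rewrite -seqsumZ.
rewrite -mulr_sumr ler_wpM2l ?mulr_ge0 ?ler0n //.
(* With its starting vertex the walk is a sequence of length [h.*2.+1]. *)
apply: (@seqsum_undup R V h.*2.+1 (2 / n.+1%:R)) => //.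
by rewrite card_ord mulrC divfK ?gt_eqF.
Qed.

Lemma expect_degree_fresh A (L : seq V) a : [disjoint A & t] ->
    {in L, forall v, v \notin t} -> uniq L -> {in L, forall v, v \notin A} ->
  expect ps (fun X => vmon A X * \prod_(v <- L) (1 + a * (c [set v] X)%:R)) =
  q 1 ^+ #|A| * (1 + a * q 1) ^+ size L.
Proof.
elim: L A => [|v L IHL] A At Lt /=.
  move=> _ _; have := @expect_mon A finset.set0 At; rewrite cards0 !expr0 !mulr1 => <-.
    by apply: eq_expect => X; rewrite big_nil /emon finset.big_set0.
  by move=> e; rewrite inE.
case/andP => vL uL LA.
have vA : v \notin A by apply: LA; rewrite mem_head.
have Lt' : {in L, forall w, w \notin t} by move=> w wL; apply: Lt; rewrite inE wL orbT.
have LA' : {in L, forall w, w \notin A} by move=> w wL; apply: LA; rewrite inE wL orbT.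
have vAt : [disjoint v |: A & t].
  apply/pred0P => w; apply/negP; rewrite /= !inE => /andP[/orP[/eqP ->|wA] wt].
    by have := Lt v (mem_head _ _); rewrite wt.
  by have /pred0P/(_ w) := At; rewrite /= wA wt.
have LvA : {in L, forall w, w \notin v |: A}.
  move=> w wL; rewrite !inE negb_or LA' // andbT.
  by apply: contraNneq vL => <-.
transitivity (expect ps (fun X =>
   vmon A X * \prod_(w <- L) (1 + a * (c [set w] X)%:R) +
   a * (vmon (v |: A) X * \prod_(w <- L) (1 + a * (c [set w] X)%:R)))).
  by apply: eq_expect => X; rewrite big_cons vmonU1; ring.
rewrite expectD expectZ (IHL _ vAt Lt' uL LvA) (IHL _ At Lt' uL LA').
have -> : #|v |: A| = #|A|.+1 by rewrite cardsU1 vA.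
rewrite [q 1 ^+ _.+1]exprS [(_ + _) ^+ _.+1]exprS.
by move: (q 1) => z; move: (z ^+ #|_|) (_ ^+ size L) => x y; ring.
Qed.

(** The degree is a sum of independent indicators, and [2^-1 ^+ c] equals [1 - c / 2] for [c] in {0,
    1}. This exponential moment controls the lower tail by Markov's inequality. *)
Lemma expect_degree :
  expect ps (fun X => 2^-1 ^+ #|[set v in ~: t | c [set v] X]|) =
  (1 - q 1 / 2) ^+ #|~: t|.
Proof.
have := @expect_degree_fresh finset.set0 (enum (~: t)) (- 2^-1).
rewrite cards0 expr0 mul1r -cardE => E.
have -> : 1 - q 1 / 2 = 1 + - 2^-1 * q 1 by field.
rewrite -E ?enum_uniq //.
- apply: eq_expect => X; rewrite /vmon finset.big_set0 mul1r big_enum /=.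
  rewrite -prodr_const big_mkcond [RHS]big_mkcond /=; apply: eq_bigr => v _.
  by rewrite !inE; case: (v \in t) => //=; case: (c _ X) => /=; field.
- by apply/pred0P => w; rewrite /= inE.
- by move=> v; rewrite mem_enum inE.
- by move=> v; rewrite inE.
Qed.

End Moments.

(** * The union bound *)

Lemma subset_setU1_notin (T : finType) (s t : {set T}) v :
  s \subset v |: t -> v \notin s -> s \subset t.
Proof.
move=> /subsetP svt vs; apply/subsetP => w ws; have := svt w ws.
by rewrite !inE => /orP[/eqP wv|//]; rewrite -wv ws in vs.
Qed.

(** * Links in the lower complex of a fixed hypergraph *)

Section LowerComplex.
Variables (n : nat) (X : {set {set 'I_n.+1}}).
Notation V := 'I_n.+1.
Notation Y := (lowerY X).
Implicit Types (s t : {set V}) (u v : V).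

Lemma lowerYP s : reflect (s != finset.set0 /\
    forall t, t != finset.set0 -> t \subset s -> t \in X) (s \in Y).
Proof.
rewrite inE; apply: (iffP andP) => -[s0 sX]; split=> //.
  by move=> t t0 ts; move/forallP/(_ t): sX; rewrite t0 ts.
by apply/forallP => t; apply/implyP => /andP[]; exact: sX.
Qed.

Lemma lowerY_closed s t : s \in Y -> t != finset.set0 -> t \subset s -> t \in Y.
Proof.
move=> /lowerYP[_ sX] t0 ts; apply/lowerYP; split=> // r r0 rt.
by apply: sX r0 _; exact: fintype.subset_trans ts.
Qed.

Lemma lowerY_setU1 t v : t \in Y -> (v |: t \in Y) = joined t [set v] X.
Proof.
move=> /lowerYP[t0 tX]; apply/lowerYP/subsetP => [[_ vtX] s|vX].
  case/imsetP => r; rewrite inE => rt ->; apply: vtX; last exact: setUS.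
  by apply/set0Pn; exists v; rewrite setU11.
split; first by apply/set0Pn; exists v; rewrite setU11.
move=> s s0 svt; have [vs|vs] := boolP (v \in s); last first.
  by apply: tX => //; exact: subset_setU1_notin svt vs.
apply: vX; apply/imsetP; exists (s :\ v); last by rewrite setD1K.
by rewrite inE subDset.
Qed.

(** A nonempty subset of [u |: (v |: t)] that omits [u] or [v] lies in a smaller face; one
    containing both belongs to the family of [[set u; v]]. *)
Lemma lowerY_setU2 t u v : t \in Y ->
  (u |: (v |: t) \in Y) =
  [&& joined t [set u] X, joined t [set v] X & joined t [set u; v] X].
Proof.
move=> tY; apply/idP/and3P => [uvtY|[uX vX uvX]].
  have sub w : w \in [set u; v] -> w |: t \in Y.
    move=> wuv; apply: lowerY_closed uvtY _ _; first by apply/set0Pn; exists w; rewrite setU11.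
    by rewrite finset.setUA setSU // sub1set.
  split; rewrite -?lowerY_setU1 ?sub ?set21 ?set22 //.
  have /lowerYP[_ uvX] := uvtY; apply/subsetP => s /imsetP[r]; rewrite inE => rt ->.
  apply: uvX; last by rewrite finset.setUA setUS.
  by apply/set0Pn; exists u; rewrite !inE eqxx.
have /lowerYP[_ tX] := tY.
have /lowerYP[_ utX] : u |: t \in Y by rewrite lowerY_setU1.
have /lowerYP[_ vtX] : v |: t \in Y by rewrite lowerY_setU1.
apply/lowerYP; split; first by apply/set0Pn; exists u; rewrite setU11.
move=> s s0 suvt; have [us|us] := boolP (u \in s); last first.
  by apply: vtX => //; exact: subset_setU1_notin suvt us.
have [vs|vs] := boolP (v \in s); last first.
  by apply: utX => //; rewrite finset.setUCA in suvt; exact: subset_setU1_notin suvt vs.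
apply: (subsetP uvX); apply/imsetP; exists (s :\: [set u; v]).
  by rewrite inE subDset -finset.setUA.
apply/setP => w; rewrite !inE.
by case: eqVneq => [->|_] //=; case: eqVneq => [->|].
Qed.

(** On a vector of sum 0, the off-diagonal products add up to minus the squared norm, so centering
    the edges at [q 2 >= 0] can only increase the form. *)
Lemma link_qform_le (R : realFieldType) t (q : nat -> R) (lam : R) h (x : V -> R) :
    t \in Y -> 0 <= q 2%N -> 0 <= lam ->
    \tr (link_mx t (joined t) q X ^+ (2 ^ h.+1)) <= lam ^+ (2 ^ h.+1) ->
    (forall v, x v != 0 -> (v \notin t) && (v |: t \in Y)) -> \sum_v x v = 0 ->
  \sum_u \sum_(v | (u != v) && (u |: (v |: t) \in Y)) x u * x v <= lam * \sum_v x v ^+ 2.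
Proof.
move=> tY q_ge0 lam_ge0 tr_le x_supp x_sum.
have := qform_le_trace (\row_v x v) (link_mx_sym _ _ _ _) lam_ge0 tr_le.
have -> : sqnorm (\row_v x v) = \sum_v x v ^+ 2.
  by apply: eq_bigr => v _; rewrite mxE.
have -> : qform (link_mx t (joined t) q X) (\row_v x v) =
    \sum_u \sum_v x u * link_mx t (joined t) q X u v * x v.
  rewrite /qform mxE exchange_big; apply: eq_bigr => v _; rewrite !mxE mulr_suml.
  by apply: eq_bigr => u _; rewrite mxE.
apply: le_trans.
have -> : \sum_u \sum_(v | (u != v) && (u |: (v |: t) \in Y)) x u * x v =
    \sum_u \sum_v x u * link_mx t (joined t) q X u v * x v +
    q 2%N * ((\sum_v x v) ^+ 2 - \sum_v x v ^+ 2).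
  have cross u : x u * (\sum_v x v) - x u ^+ 2 = \sum_(v | v != u) x u * x v.
    by rewrite mulr_sumr (bigD1 u) //= expr2 addrAC subrr add0r.
  rewrite [in RHS]expr2 mulr_suml -sumrB mulr_sumr -big_split /=; apply: eq_bigr => u _.
  rewrite cross.
  rewrite [\sum_v x u * _ * _](bigD1 u) //= mxE eqxx mulr0 mul0r add0r.
  rewrite big_mkcondr [LHS](eq_bigl (fun v => v != u)); last by move=> v; rewrite eq_sym.
  rewrite mulr_sumr -big_split /=; apply: eq_bigr => v vu.
  have [->|xu0] := eqVneq (x u) 0; first by rewrite !mul0r mulr0 addr0 if_same.
  have [->|xv0] := eqVneq (x v) 0; first by rewrite !mulr0 addr0 if_same.
  have /andP[ut utY] := x_supp u xu0; have /andP[vt vtY] := x_supp v xv0.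
  rewrite mxE eq_sym vu ut vt lowerY_setU2 // -!lowerY_setU1 // utY vtY /=.
  by case: (joined t [set u; v] X); rewrite /= ?mulr1n ?mulr0n; ring.
rewrite gerDl x_sum expr0n /= sub0r mulrN oppr_le0 mulr_ge0 //.
by apply: sumr_ge0 => v _; exact: sqr_ge0.
Qed.

(** The hypotheses range over all vertex sets of the given sizes, faces or not, so that their
    failure probabilities can be summed without conditioning on a set being a face. *)
Lemma homology_vanishes_lowerY (R : realFieldType) k (q : {set V} -> nat -> R) (lam D : R) h :
    (forall t, 0 <= q t 2%N) -> 0 <= lam ->
    (forall t, #|t| = k.+1 ->
       \tr (link_mx t (joined t) (q t) X ^+ (2 ^ h.+1)) <= lam ^+ (2 ^ h.+1)) ->
    (forall s, #|s| = k.+2 -> D <= #|[set v in ~: s | joined s [set v] X]|%:R) ->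
    k.+2%:R * lam < D ->
  homology_vanishes Y k.+1.
Proof.
move=> q_ge0 lam_ge0 tr_le deg; apply: garland_homology => [s t|t tYk|s sYk].
- exact: lowerY_closed.
- have /andP[tY /eqP sz] : (t \in Y) && (#|t| == k.+1) by move: tYk; rewrite inE.
  by move=> x; exact: link_qform_le (tr_le t sz).
- have /andP[sY /eqP sz] : (s \in Y) && (#|s| == k.+2) by move: sYk; rewrite inE.
  apply: le_trans (deg s sz) _; rewrite ler_nat subset_leq_card //.
  apply/subsetP => v; rewrite [in X in X -> _]finset.in_set [in X in _ -> X]finset.in_set.
  by rewrite lowerY_setU1 // finset.in_setC.
Qed.

End LowerComplex.

(* By Pascal's rule this is the product of the g (i + l) ^+ 'C(m, l). *)
Fixpoint prod_binom (R : pzRingType) (g : nat -> R) i m : R :=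
  if m is m'.+1 then prod_binom g i m' * prod_binom g i.+1 m' else g i.

(** Subsets of [t] are split by whether they contain a chosen vertex, which matches the recursion of
    [prod_binom]. *)
Lemma prod_powerset (R : comPzRingType) (T : finType) (g : nat -> R) i (t : {set T}) :
  \prod_(s in powerset t) g (i + #|s|)%N = prod_binom g i #|t|.
Proof.
move sz: #|t| => m; elim: m i t sz => [|m IHm] i t sz /=.
  by rewrite (cards0_eq sz) powerset0 big_set1 cards0 addn0.
have /card_gt0P[v vt] : (0 < #|t|)%N by rewrite sz.
have szD : #|t :\ v| = m by move: sz; rewrite (cardsD1 v) vt => -[].
rewrite (bigID [pred s : {set T} | v \in s]) /= mulrC; congr (_ * _).
  rewrite -(IHm _ _ szD); apply: eq_bigl => s; rewrite !inE.
  by rewrite subsetD1.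
rewrite -(IHm i.+1 _ szD) (reindex_onto (fun s => v |: s) (fun s => s :\ v)) /=; last first.
  by move=> s /andP[_ vs]; rewrite setD1K.
apply: eq_big => s.
  rewrite !inE eqxx /= andbT subsetD1 subUset sub1set vt /=.
  apply/andP/andP => -[st H]; split=> //; first by rewrite -(eqP H) setD11.
  by rewrite setU1K.
rewrite !inE => /andP[_ /eqP vs].
by rewrite cardsU1 -vs setD11 add1n addnS.
Qed.

Lemma prod_binom_itv (R : realFieldType) (p : R) (g : nat -> R) i m : 0 <= p ->
  (forall k, p <= g k <= 1) -> p ^+ (2 ^ m) <= prod_binom g i m <= 1.
Proof.
move=> p0 gp; elim: m i => [|m IHm] i /=; first by rewrite expr1.
have /andP[a1 b1] := IHm i; have /andP[a2 b2] := IHm i.+1.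
have pm : 0 <= p ^+ (2 ^ m) by rewrite exprn_ge0.
rewrite expnS mul2n -addnn exprD ler_pM // mulr_ile1 //; exact: (le_trans pm).
Qed.

Lemma card_subsets_le (T : finType) m : (#|[set s : {set T} | #|s| == m]| <= #|T| ^ m)%N.
Proof.
rewrite card_draws; apply: (@leq_trans (#|T| ^_ m)).
  by rewrite -bin_ffact leq_pmulr // fact_gt0.
elim: m #|T| => [|m IHm] [|k] //; rewrite ffactSS expnS leq_mul //.
by apply: leq_trans (IHm k) _; case: m {IHm} => // m; rewrite leq_exp2r.
Qed.

Lemma card_ord_lt (n i : nat) : (i <= n)%N -> #|[set v : 'I_n | (v < i)%N]| = i.
Proof.
by move=> le_in; rewrite -sum1dep_card (big_ord_narrow le_in) big_const_ord iter_addn_0 mul1n.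
Qed.

(** Markov's inequality for the traces at sets of size [k.+1] and for the degrees at sets of size
    [k.+2]. The same [rho] is the product of the vertex and edge probabilities in the former links
    and the vertex probability in the latter, by the recursion of [prod_binom]. *)
Lemma expect_nonvanishing (n : nat) (R : realFieldType) (ps : {set 'I_n.+1} -> R)
    (g : nat -> R) k h (B : R) :
    (forall s, s \in proper_faces n.+1 -> ps s = g #|s|) ->
    (forall i, 0 <= g i <= 1) -> (k.+4 < n.+1)%N ->
    let N : R := n.+1%:R in
    let rho := prod_binom g 1 k.+2 in
    let d := N * rho in
    1 <= d -> 0 <= B ->
    (forall m : nat, m%:R < d / 8 -> 1 <= B * 2^-1 ^+ m) ->
  expect ps (fun X => (~~ homology_vanishes (lowerY X) k.+1)%:R) <=
  N ^+ k.+1 * (N * (2 ^ h).*2.+2%:R ^+ (2 ^ h).*2.+1 * d ^+ (2 ^ h)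
     / (d / (16 * k.+2%:R)) ^+ (2 ^ h).*2) +
  N ^+ k.+2 * (B * (1 - rho / 2) ^+ (n.+1 - k.+2)).
Proof.
move=> ps_card g_itv kn N rho d d_ge1 B_ge0 B_le.
have ps_itv s : s \in proper_faces n.+1 -> 0 <= ps s <= 1 by move=> /ps_card ->.
have d_gt0 : 0 < d by apply: lt_le_trans d_ge1.
pose q (t : {set 'I_n.+1}) i := \prod_(s in powerset t) g (i + #|s|)%N.
have q_itv t i : 0 <= q t i <= 1.
  rewrite /q prod_powerset; have /andP[q0 ->] := prod_binom_itv i #|t| (lexx 0) g_itv.
  by rewrite (le_trans _ q0) ?exprn_ge0.
have expect_q (t : {set 'I_n.+1}) m (Z : {set {set 'I_n.+1}}) : (m + #|t| < n.+1)%N ->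
    (forall z, z \in Z -> [disjoint z & t] && (0 < #|z| <= m)%N) ->
    expect ps (fun X => \prod_(z in Z) (joined t z X)%:R) = \prod_(z in Z) q t #|z|.
  move=> mt Zt; apply: (expect_joined ps_card) => z /Zt/and3P[-> z0 zm].
  by rewrite -card_gt0 z0 /=; apply: leq_ltn_trans mt; rewrite leq_add2r.
(* With degree threshold [D = d / 8], this makes [k.+2%:R * lam = d / 16 < D]. *)
pose lam := d / (16 * k.+2%:R).
have lam_gt0 : 0 < lam by rewrite /lam divr_gt0 // mulr_gt0 ?ltr0n.
pose tr t X : R := \tr (link_mx t (joined t) (q t) X ^+ (2 ^ h).*2) / lam ^+ (2 ^ h).*2.
pose dg (s : {set 'I_n.+1}) X : R := B * 2^-1 ^+ #|[set v in ~: s | joined s [set v] X]|.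
have tr_ge0 t X : 0 <= tr t X.
  rewrite /tr divr_ge0 ?exprn_ge0 ?(ltW lam_gt0) // -mul2n mxtrace_even_ge0 //.
  exact: link_mx_sym.
have dg_ge0 s X : 0 <= dg s X by rewrite /dg mulr_ge0 ?exprn_ge0 ?invr_ge0.
(* All summands are nonnegative, and when homology survives one of them is at least 1. *)
apply: (@le_trans _ _ (expect ps (fun X =>
    \sum_(t in [set t : {set 'I_n.+1} | #|t| == k.+1]) tr t X +
    \sum_(s in [set s : {set 'I_n.+1} | #|s| == k.+2]) dg s X))).
  apply: le_expect => // X.
  have S1 : 0 <= \sum_(t in [set t : {set 'I_n.+1} | #|t| == k.+1]) tr t X by exact: sumr_ge0.
  have S2 : 0 <= \sum_(s in [set s : {set 'I_n.+1} | #|s| == k.+2]) dg s X by exact: sumr_ge0.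
  have [|Nvan] := boolP (homology_vanishes _ _); first by rewrite addr_ge0.
  have [/exists_inP[t tk tr_gt]|/exists_inPn tr_le] := boolP
      [exists t in [set t : {set 'I_n.+1} | #|t| == k.+1], 1 < tr t X].
    rewrite (bigD1 t) //= -addrA -[leLHS]addr0 lerD ?(ltW tr_gt) // addr_ge0 //.
    exact: sumr_ge0.
  have [/exists_inP[s sk dg_gt]|/exists_inPn dg_le] := boolP
      [exists s in [set s : {set 'I_n.+1} | #|s| == k.+2],
        #|[set v in ~: s | joined s [set v] X]|%:R < d / 8].
    rewrite [\sum_(s in _) dg _ _](bigD1 s) //= addrCA -[leLHS]addr0 lerD ?B_le //.
    by rewrite addr_ge0 ?sumr_ge0.
  case/negP: Nvan; apply: (@homology_vanishes_lowerY _ _ R k q lam (d / 8) h).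
  - by move=> t; case/andP: (q_itv t 2%N).
  - exact: ltW.
  - move=> t tk; have := tr_le t; rewrite inE tk eqxx => /(_ isT).
    by rewrite -leNgt /tr ler_pdivrMr ?exprn_gt0 // mul1r -mul2n -expnS.
  - by move=> s sk; have := dg_le s; rewrite inE sk eqxx => /(_ isT); rewrite -leNgt.
  - have k_neq0 : (k.+2%:R : R) != 0 by rewrite pnatr_eq0.
    have -> : k.+2%:R * lam = d / 16 by rewrite /lam; move: (k.+2%:R : R) k_neq0 => y y0; field.
    lra.
rewrite expectD !expect_sum; apply: lerD.
  apply: (@le_trans _ _ (\sum_(t in [set t : {set 'I_n.+1} | #|t| == k.+1])
     (N * (2 ^ h).*2.+2%:R ^+ (2 ^ h).*2.+1 * d ^+ (2 ^ h) / lam ^+ (2 ^ h).*2))).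
    apply: ler_sum => t; rewrite inE => /eqP tk.
    have -> : expect ps (tr t) = expect ps (fun X =>
        (lam ^+ (2 ^ h).*2)^-1 * \tr (link_mx t (joined t) (q t) X ^+ (2 ^ h).*2)).
      by apply: eq_expect => X; rewrite mulrC.
    rewrite expectZ [leRHS]mulrC ler_wpM2l ?invr_ge0 ?exprn_ge0 ?(ltW lam_gt0) //.
    have dE : d = N * (q t 1%N * q t 2%N) by rewrite /q !prod_powerset tk.
    rewrite dE; apply: (expect_trace ps_itv (q_itv t)).
    - by move=> Z Zt; apply: (expect_q t 2) => //; rewrite tk add2n ltnW.
    - by rewrite expn_gt0.
    - by rewrite -[n.+1%:R]/N -dE.
  rewrite sumr_const -[leLHS]mulr_natl ler_wpM2r //.
    by rewrite !mulr_ge0 ?invr_ge0 ?exprn_ge0 ?(ltW lam_gt0) ?(ltW d_gt0) ?ler0n.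
  by rewrite /N -natrX ler_nat (leq_trans (card_subsets_le _ _)) // card_ord.
apply: (@le_trans _ _ (\sum_(s in [set s : {set 'I_n.+1} | #|s| == k.+2])
     (B * (1 - rho / 2) ^+ (n.+1 - k.+2)))).
  apply: ler_sum => s; rewrite inE => /eqP sk; rewrite expectZ.
  rewrite (expect_degree (q := q s)).
    rewrite cardsCs finset.setCK card_ord sk.
    by rewrite /q prod_powerset sk.
  by move=> Z Zt; apply: (expect_q s 2) => //; rewrite sk add2n.
rewrite sumr_const -[leLHS]mulr_natl ler_wpM2r //.
  have /andP[rho0 rho1] : 0 <= rho <= 1.
    have /andP[r0 ->] := prod_binom_itv 1 k.+2 (lexx 0) g_itv.
    by rewrite (le_trans _ r0) ?exprn_ge0.
  by rewrite mulr_ge0 ?exprn_ge0 // subr_ge0; lra.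
by rewrite /N -natrX ler_nat (leq_trans (card_subsets_le _ _)) // card_ord.
Qed.

From mathcomp Require Import all_classical all_reals all_analysis.
Import numFieldNormedType.Exports.

(** * Asymptotics *)

(** From [c * y <= expR (c * y)] with [c = e / k.+1%:R], raised to the power [k.+1]: the spare
    factor [y] absorbs [C] once [y] exceeds [C / c ^+ k.+1]. *)
Lemma expR_dominates (R : realType) (C e : R) k : 0 < e ->
  exists2 y0, 0 <= y0 & forall y, y0 <= y -> C * y ^+ k <= expR (e * y).
Proof.
move=> e_gt0; pose c := e / k.+1%:R.
have c_gt0 : 0 < c by rewrite divr_gt0 ?ltr0n.
exists (Num.max 0 (C / c ^+ k.+1)); first by rewrite le_max lexx.
move=> y; rewrite ge_max => /andP[y_ge0]; rewrite ler_pdivrMr ?exprn_gt0 // => Cy.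
have -> : e * y = k.+1%:R * (c * y).
  by rewrite /c mulrA mulrCA mulfV ?mulr1 // pnatr_eq0.
rewrite expRM_natl; apply: (@le_trans _ _ ((c * y) ^+ k.+1)).
  by rewrite exprMn [y ^+ k.+1]exprS mulrA ler_wpM2r ?exprn_ge0 // mulrC.
have cy_ge0 : 0 <= c * y by rewrite mulr_ge0 // ltW.
rewrite lerXn2r ?nnegrE ?expR_ge0 //.
by apply: le_trans (expR_ge1Dx _); rewrite lerDr ler01.
Qed.

(** Isolates an [h]-th power whose base is small as soon as [d] outgrows [K ^+ 2 * L ^+ 2]. *)
Lemma trace_bound_ratioE (R : realFieldType) (N K L d : R) k h : 0 < d -> 0 < L ->
  N ^+ k.+1 * (N * K ^+ h.*2.+1 * d ^+ h / (d / L) ^+ h.*2) =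
  N ^+ k.+2 * (K * (K ^+ 2 * L ^+ 2 / d) ^+ h).
Proof.
move=> d_gt0 L_gt0; rewrite [K ^+ _.+1]exprS -mul2n !exprM [N ^+ k.+2]exprSr.
have -> : K ^+ 2 * L ^+ 2 / d = K ^+ 2 * d / (d / L) ^+ 2.
  by field; rewrite ?lt0r_neq0.
rewrite [(_ / _) ^+ h]exprMn [(_ * d) ^+ h]exprMn exprVn.
by move: ((K ^+ 2) ^+ h) (d ^+ h) ((_ ^+ h)^-1) (N ^+ k.+1) => u v w x; ring.
Qed.

(** With [m = 2 ^+ k.+2], the union bound costs at most [expR (2 * y * m)]. The trace term gains
    [expR (- (6 * m * y))], the degree term [expR (- (d / 8))], and each product falls below
    [expR (- 3 * y)]. *)
Lemma expect_nonvanishing_le (R : realType) (n : nat) (ps : {set 'I_n.+1} -> R)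
    (g : nat -> R) (p eps : R) (c k : nat) :
  let y := ln n%:R in let b := y / - ln p in
  (forall s, s \in proper_faces n.+1 -> ps s = g #|s|) ->
  0 < p < 1 -> (forall i, p <= g i <= 1) -> (1 < n)%N -> 0 < eps < 1 ->
  12 <= eps * 2 ^+ c ->
  2 ^+ k.+2 * - ln p <= (1 - eps) * y ->
  (64 * 2 ^+ c) ^+ 2 * b ^+ 4 <= expR (eps / 2 * y) ->
  4 * 2 ^+ c * b <= expR y ->
  8 * (2 * b * y + 3 * y) <= expR (eps * y) ->
  expect ps (fun X => (~~ homology_vanishes (lowerY X) k.+1)%:R) <= 2 * expR (- 3 * y).
Proof.
move=> y b ps_card /andP[p_gt0 p_lt1] g_itv n_gt1 /andP[eps_gt0 eps_lt1] c_ge m_le E1 E2 E3.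
have n_gt0 : 0 < n%:R :> R by rewrite ltr0n ltnW.
have expRy : expR y = n%:R by rewrite lnK.
have y_gt0 : 0 < y by rewrite ln_gt0 // ltr1n.
have a_gt0 : 0 < - ln p by rewrite oppr_gt0 ln_lt0 // p_gt0.
pose m : R := 2 ^+ k.+2.
have m_ge1 : 1 <= m by rewrite exprn_ege1 // ler1n.
have m_leb : m <= b.
  rewrite /b ler_pdivlMr //; apply: le_trans m_le _.
  by rewrite ler_piMl ?(ltW y_gt0) // gerBl ltW.
have b_gt0 : 0 < b by apply: lt_le_trans m_leb; lra.
have c_ge1 : 1 <= 2 ^+ c :> R by rewrite exprn_ege1 // ler1n.
have k_le : k.+2%:R <= m :> R by rewrite /m -natrX ler_nat ltnW // ltn_expl.
have k_lt : (4 * 2 ^ k.+2 <= n)%N.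
  rewrite -(ler_nat R) natrM natrX -/m -expRy; apply: le_trans E2.
  by rewrite -[4 * 2 ^+ c * b]mulrA ler_wpM2l // (le_trans m_leb) // ler_peMl // ltW.
have k_ltm : (k.+2 < 2 ^ k.+2)%N by rewrite ltn_expl.
pose N : R := n.+1%:R; pose rho := prod_binom g 1 k.+2; pose d := N * rho.
have g_itv0 i : 0 <= g i <= 1.
  by have /andP[gp ->] := g_itv i; rewrite (le_trans _ gp) // ltW.
have /andP[rho_ge rho_le1] := prod_binom_itv 1 k.+2 (ltW p_gt0) g_itv.
have N_ge : expR y <= N by rewrite expRy /N ler_nat.
have N_le : N <= expR (2 * y).
  rewrite expRM_natl expRy /N -natrX ler_nat -mulnn (@leq_trans (2 * n)) //.
    by rewrite mul2n -addnn -addn1 leq_add2l ltnW.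
  by rewrite leq_mul2r n_gt1 orbT.
(* [rho] is at least [p ^+ (2 ^ k.+2)], and the bound on [2 ^+ k.+2 * - ln p] turns this into a
   power of n. *)
have rho_ge' : expR (- ((1 - eps) * y)) <= rho.
  apply: le_trans rho_ge; rewrite -[X in X ^+ _](lnK p_gt0) -expRM_natl ler_expR.
  by rewrite natrX -[ln p]opprK mulrN lerN2.
have d_ge : expR (eps * y) <= d.
  have -> : eps * y = y + - ((1 - eps) * y) by ring.
  by rewrite expRD ler_pM ?expR_ge0.
have d_ge1 : 1 <= d by apply: le_trans d_ge; rewrite -expR0 ler_expR mulr_ge0 // ltW.
have d_gt0 : 0 < d by apply: lt_le_trans d_ge1.
have kn : (k.+4 < n.+1)%N.
  by clear -k_lt k_ltm; move: (2 ^ k.+2)%N k_lt k_ltm => z; lia.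
(* The constant [B = expR (d / 8)] suffices because [2 <= expR 1]. *)
have B_le (i : nat) : i%:R < d / 8 -> 1 <= expR (d / 8) * 2^-1 ^+ i.
  move=> id; rewrite exprVn -[leLHS](@mulfV _ (2 ^+ i)) ?expf_neq0 //.
  rewrite ler_wpM2r ?invr_ge0 ?exprn_ge0 //; apply: (@le_trans _ _ (expR i%:R)); last by rewrite ler_expR ltW.
  rewrite -[i%:R]mulr1 expRM_natl lerXn2r ?nnegrE ?expR_ge0 //.
  by have := expR_ge1Dx (1 : R); lra.
(* The exponent [k.+2 + c] makes half the trace power equal to [m * 2 ^+ c], proportional to the
   cost of the union bound. *)
have := @expect_nonvanishing n R ps g k (k.+2 + c) (expR (d / 8)) ps_card g_itv0 kn.
move=> /(_ d_ge1 (expR_ge0 _) B_le); rewrite -/N -/rho -/d => H; apply: le_trans H _.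
have L_gt0 : 0 < 16 * k.+2%:R :> R by rewrite mulr_gt0 ?ltr0n.
rewrite trace_bound_ratioE //.
have N_exp : N ^+ k.+2 <= expR (2 * y * m).
  apply: (@le_trans _ _ (expR (2 * y) ^+ k.+2)).
    by rewrite lerXn2r ?nnegrE ?expR_ge0.
  by rewrite -expRM_natl ler_expR mulrC ler_wpM2l ?mulr_ge0 ?(ltW y_gt0).
have -> : 2 * expR (- 3 * y) = expR (- 3 * y) + expR (- 3 * y).
  by rewrite mulr_natl mulr2n.
apply: lerD.
  set h := (2 ^ (k.+2 + c))%N; set K : R := h.*2.+2%:R; set L : R := 16 * k.+2%:R.
  pose c2 : R := 2 ^+ c.
  have [c2_ge1 E1' E2' c2_ge] : [/\ 1 <= c2, (64 * c2) ^+ 2 * b ^+ 4 <= expR (eps / 2 * y),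
    4 * c2 * b <= expR y & 12 <= eps * c2] by [].
  have c2_gt0 : 0 < c2 by lra.
  have hE : h%:R = m * c2 by rewrite /h natrX exprD.
  have mc_ge1 : 1 <= m * c2 by rewrite mulr_ege1.
  have K_ge0 : 0 <= K by rewrite ler0n.
  have K_le : K <= 4 * c2 * m.
    have -> : K = 2 * (m * c2) + 2 by rewrite /K -addn2 natrD -muln2 natrM hE mulrC.
    by rewrite -mulrA [c2 * m]mulrC; lra.
  have L_ge0 : 0 <= L by rewrite mulr_ge0 ?ler0n.
  have L_le : L <= 16 * m by rewrite ler_wpM2l.
  clearbody K L d c2 m b.
  have KL_le : K ^+ 2 * L ^+ 2 <= expR (eps / 2 * y).
    apply: le_trans E1'; rewrite -exprMn.
    have -> : (64 * c2) ^+ 2 * b ^+ 4 = (64 * c2 * b ^+ 2) ^+ 2.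
      by rewrite [RHS]exprMn -[in RHS]exprM.
    rewrite lerXn2r ?nnegrE ?mulr_ge0 ?exprn_ge0 ?(ltW c2_gt0) ?(ltW b_gt0) //.
    apply: (@le_trans _ _ ((4 * c2 * m) * (16 * m))); first by rewrite ler_pM.
    have -> : 4 * c2 * m * (16 * m) = 64 * c2 * m ^+ 2 by ring.
    rewrite ler_wpM2l ?mulr_ge0 ?(ltW c2_gt0) //.
    by rewrite lerXn2r ?nnegrE ?(ltW b_gt0) // (le_trans _ m_ge1).
  have ratio_le : K ^+ 2 * L ^+ 2 / d <= expR (- (eps / 2 * y)).
    rewrite ler_pdivrMr //; apply: le_trans KL_le _.
    rewrite [X in expR X <= _](_ : _ = - (eps / 2 * y) + eps * y); last by field.
    by rewrite expRD ler_wpM2l ?expR_ge0.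
  (* The hypothesis [12 <= eps * 2 ^+ c] is what yields the coefficient 6 here. *)
  have pow_le : (K ^+ 2 * L ^+ 2 / d) ^+ h <= expR (- (6 * m * y)).
    apply: (@le_trans _ _ (expR (- (eps / 2 * y)) ^+ h)).
      by rewrite lerXn2r ?nnegrE ?expR_ge0 ?divr_ge0 ?mulr_ge0 ?exprn_ge0 ?(ltW d_gt0).
    rewrite -expRM_natl ler_expR mulrN lerN2 hE.
    have -> : m * c2 * (eps / 2 * y) = (eps * c2 / 2) * (m * y) by field.
    rewrite -[6 * m * y]mulrA ler_wpM2r ?mulr_ge0 ?(ltW y_gt0) //; first by lra.
    by lra.
  have K_leE : K <= expR y.
    apply: le_trans E2'; apply: le_trans K_le _; rewrite ler_wpM2l //.
    by rewrite mulr_ge0 // ltW.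
  apply: (@le_trans _ _ (expR (2 * y * m) * (expR y * expR (- (6 * m * y))))).
    apply: ler_pM N_exp _; rewrite ?exprn_ge0 ?ler0n //.
      by rewrite mulr_ge0 // exprn_ge0 // divr_ge0 ?mulr_ge0 ?exprn_ge0 ?(ltW d_gt0).
    by rewrite ler_pM // exprn_ge0 // divr_ge0 ?mulr_ge0 ?exprn_ge0 ?(ltW d_gt0).
  rewrite -!expRD ler_expR.
  have my_ge : 0 <= (m - 1) * y by rewrite mulr_ge0 ?(ltW y_gt0) // subr_ge0.
  clear -my_ge y_gt0; nra.
have rho_ge0 : 0 <= rho by apply: le_trans rho_ge'; exact: expR_ge0.
have pow_le : (1 - rho / 2) ^+ (n.+1 - k.+2) <= expR (- (d / 4)).
  apply: (@le_trans _ _ (expR (- (rho / 2)) ^+ (n.+1 - k.+2))).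
    rewrite lerXn2r ?nnegrE ?expR_ge0 //; last exact: expR_ge1Dx.
    by rewrite subr_ge0 ler_pdivrMr // mul1r (le_trans rho_le1) // ler1n.
  rewrite -expRM_natl ler_expR mulrN lerN2 /d.
  (* At least half of the vertices lie outside a set of size [k.+2], which turns [d / 2] into
     [d / 4]. *)
  have : N <= (n.+1 - k.+2)%:R * 2.
    rewrite -natrM ler_nat; clear -k_lt k_ltm.
    by move: (2 ^ k.+2)%N k_lt k_ltm => z; lia.
  move=> /(ler_wpM2r rho_ge0) Nrho; clear -Nrho; lra.
apply: (@le_trans _ _ (expR (2 * y * m) * (expR (d / 8) * expR (- (d / 4))))).
  apply: ler_pM N_exp _; rewrite ?exprn_ge0 ?ler0n //.
    rewrite mulr_ge0 ?expR_ge0 // exprn_ge0 // subr_ge0.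
    by rewrite ler_pdivrMr // mul1r (le_trans rho_le1) // ler1n.
  by rewrite ler_wpM2l ?expR_ge0.
rewrite -!expRD ler_expR.
have my_le : m * y <= b * y by rewrite ler_wpM2r // ltW.
clear -my_le d_ge E3; lra.
Qed.

(** Exponentiating in base 2: the summand -1 moves to the left as the exponent [j.+1], and [delta]
    becomes the factor [2^(-delta)], written with [expR]. *)
Lemma exp2_le_of_logb (R : realType) (p delta : R) (n j : nat) :
  0 < p < 1 -> 0 < delta -> (1 < n)%N ->
  j%:R <= logb 2 (logb p^-1 n%:R) - 1 - delta ->
  2 ^+ j.+1 * - ln p <= expR (- (delta * ln 2)) * ln n%:R.
Proof.
move=> /andP[p_gt0 p_lt1] delta_gt0 n_gt1.
have a_gt0 : 0 < - ln p by rewrite oppr_gt0 ln_lt0 // p_gt0.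
have y_gt0 : 0 < ln n%:R :> R by rewrite ln_gt0 // ltr1n.
have ln2_gt0 : 0 < ln 2 :> R by rewrite ln_gt0 // ltr1n.
rewrite /logb lnV //; set z := ln n%:R / - ln p => j_le.
have z_gt0 : 0 < z by rewrite divr_gt0.
have : (j.+1%:R + delta) * ln 2 <= ln z.
  by rewrite -ler_pdivlMr // -natr1; move: j_le; lra.
rewrite -ler_expR lnK // mulrDl expRD expRM_natl lnK ?posrE //.
rewrite ler_pdivlMr // => H.
by rewrite expRN -ler_pdivrMl ?invr_gt0 ?expR_gt0 // invrK mulrA [expR _ * _]mulrC.
Qed.

(** The constant [c] depends on [eps] only, so a single [n0] serves every dimension; the remaining
    bounds compare a polynomial in [y] with an exponential. *)
Lemma eventually_large (R : realType) (p delta : R) : 0 < p < 1 -> 0 < delta ->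
  let eps := 1 - expR (- (delta * ln 2)) in
  exists c n0 : nat, forall n, (n0 <= n)%N ->
  let y := ln n%:R in let b := y / - ln p in
  [/\ (1 < n)%N, 0 < eps < 1 , 12 <= eps * 2 ^+ c &
      [/\ (64 * 2 ^+ c) ^+ 2 * b ^+ 4 <= expR (eps / 2 * y),
       4 * 2 ^+ c * b <= expR y & 8 * (2 * b * y + 3 * y) <= expR (eps * y)]].
Proof.
move=> /andP[p_gt0 p_lt1] delta_gt0 eps.
have a_gt0 : 0 < - ln p by rewrite oppr_gt0 ln_lt0 // p_gt0.
have a_neq0 : ln p != 0 by rewrite -oppr_eq0 gt_eqF.
have eps_itv : 0 < eps < 1.
  rewrite /eps subr_gt0 gtrBl expR_gt0 andbT -[ltRHS]expR0 ltr_expR oppr_lt0.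
  by rewrite mulr_gt0 // ln_gt0 // ltr1n.
have /andP[eps_gt0 _] := eps_itv.
have [c c_ge] : exists c : nat, 12 <= eps * 2 ^+ c.
  exists (Num.bound (12 / eps)); rewrite mulrC -ler_pdivrMr //.
  have eps12 : 0 <= 12 / eps by rewrite divr_ge0 // ltW.
  apply: le_trans (ltW (archi_boundP eps12)) _.
  by rewrite -natrX ler_nat ltnW // ltn_expl.
have eps2_gt0 : 0 < eps / 2 by rewrite divr_gt0.
have [y1 _ H1] := @expR_dominates R ((64 * 2 ^+ c) ^+ 2 / (- ln p) ^+ 4) (eps / 2) 4 eps2_gt0.
have [y2 _ H2] := @expR_dominates R (4 * 2 ^+ c / - ln p) 1 1 ltr01.
have [y3 _ H3] := @expR_dominates R (16 / - ln p + 24) eps 2 eps_gt0.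
(* The entry 1 ensures [y <= y ^+ 2] and excludes [n <= 1]. *)
pose y0 := Num.max (Num.max y1 y2) (Num.max y3 1).
exists c, (Num.bound (expR y0)) => n n_ge y b.
have y0_le : y0 <= y.
  have bnd := archi_boundP (expR_ge0 y0).
  have n_le : expR y0 <= n%:R by apply: le_trans (ltW bnd) _; rewrite ler_nat.
  have n_gt0 : 0 < n%:R :> R by apply: lt_le_trans n_le; exact: expR_gt0.
  by rewrite -ler_expR /y lnK.
move: y0_le; rewrite /y0 !ge_max => /andP[/andP[y1_le y2_le] /andP[y3_le y_ge1]].
have n_gt1 : (1 < n)%N.
  rewrite ltnNge; apply/negP => n_le1; have : y <= 0.
    by rewrite /y ln_le0 // lern1.
  by lra.
split=> //; split.
- have -> : (64 * 2 ^+ c) ^+ 2 * b ^+ 4 = (64 * 2 ^+ c) ^+ 2 / (- ln p) ^+ 4 * y ^+ 4.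
    by rewrite /b expr_div_n [y ^+ 4 / _]mulrC mulrA.
  exact: H1.
- have -> : 4 * 2 ^+ c * b = 4 * 2 ^+ c / - ln p * y ^+ 1.
    by rewrite expr1 /b [y / _]mulrC mulrA.
  by rewrite -[y in leRHS]mul1r; exact: H2.
- apply: le_trans (H3 y y3_le).
  have -> : 8 * (2 * b * y + 3 * y) = 16 / - ln p * y ^+ 2 + 24 * y.
    by rewrite /b; move: (ln p) a_neq0 => l l0; field.
  rewrite [leRHS]mulrDl lerD2l ler_wpM2l //.
  by rewrite expr2 ler_peMl //; lra.
Qed.

Lemma lower_prob_ge (R : realType) (n : nat) (ps : {set 'I_n.+1} -> R)
    (g : nat -> R) (p delta : R) (c : nat) :
  let y := ln n%:R in let b := y / - ln p in let eps := 1 - expR (- (delta * ln 2)) in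
  (forall s, s \in proper_faces n.+1 -> ps s = g #|s|) ->
  0 < p < 1 -> (forall i, p <= g i <= 1) -> 0 < delta ->
  [/\ (1 < n)%N, 0 < eps < 1 , 12 <= eps * 2 ^+ c &
      [/\ (64 * 2 ^+ c) ^+ 2 * b ^+ 4 <= expR (eps / 2 * y),
       4 * 2 ^+ c * b <= expR y & 8 * (2 * b * y + 3 * y) <= expR (eps * y)]] ->
  1 - 2 * harmonic n <= lower_prob ps (fun Y =>
     `[< forall j : nat, (0 < j)%N ->
           (j%:R <= logb 2 (logb p^-1 n%:R) - 1 - delta) ->
           homology_vanishes Y j >]) <= 1.
Proof.
move=> y b eps ps_card p_itv g_itv delta_gt0 [n_gt1 eps_itv c_ge [E1 E2 E3]].
have /andP[p_gt0 p_lt1] := p_itv.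
have ps_itv s : s \in proper_faces n.+1 -> 0 <= ps s <= 1.
  by move=> /ps_card ->; have /andP[pg ->] := g_itv #|s|; rewrite (le_trans _ pg) // ltW.
pose small j := (j%:R <= logb 2 (logb p^-1 n%:R) - 1 - delta).
pose good (Y : {set {set 'I_n.+1}}) :=
  `[< forall j, (0 < j)%N -> small j -> homology_vanishes Y j >].
rewrite -/(lower_prob ps good) lower_prob_expect.
have small_m k : small k.+1 -> 2 ^+ k.+2 * - ln p <= (1 - eps) * y.
  by move=> /(exp2_le_of_logb p_itv delta_gt0 n_gt1); rewrite /eps opprB addrC subrK.
have a_gt0 : 0 < - ln p by rewrite oppr_gt0 ln_lt0.
have y_gt0 : 0 < y by rewrite ln_gt0 // ltr1n.
have expRy : expR y = n%:R by rewrite lnK // posrE ltr0n ltnW.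
have c_ge1 : 1 <= 2 ^+ c :> R by rewrite exprn_ege1 // ler1n.
(* Admissible dimensions are at most n, so the union over them is finite. *)
have small_lt k : small k.+1 -> (k < n)%N.
  move=> /small_m m_le; rewrite -(ltr_nat R) -expRy; apply: lt_le_trans E2.
  have b_gt0 : 0 < b by rewrite divr_gt0.
  apply: (@lt_le_trans _ _ (2 ^+ k.+2)).
    rewrite -natrX ltr_nat; apply: (@ltn_trans k.+2) => //; exact: ltn_expl.
  apply: (@le_trans _ _ b).
    rewrite /b ler_pdivlMr //; apply: le_trans m_le _.
    by have /andP[e0 e1] := eps_itv; rewrite ler_piMl ?(ltW y_gt0) // gerBl ltW.
  by rewrite ler_peMl ?(ltW b_gt0) //; lra.
have total : expect ps (fun X => (good (lowerY X))%:R) +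
    expect ps (fun X => (~~ good (lowerY X))%:R) = 1.
  rewrite -expectD -[RHS](expect1 ps); apply: eq_expect => X.
  by case: (good _); rewrite ?addr0 ?add0r.
have bad_ge0 : 0 <= expect ps (fun X => (~~ good (lowerY X))%:R).
  by apply: sumr_ge0 => X _; rewrite mulr_ge0 ?lower_weight_ge0.
have bad_le : expect ps (fun X => (~~ good (lowerY X))%:R) <=
    \sum_(k < n | small k.+1) 2 * expR (- 3 * y).
  apply: (@le_trans _ _ (expect ps (fun X => \sum_(k < n | small k.+1)
      (~~ homology_vanishes (lowerY X) k.+1)%:R))).
    apply: le_expect => // X.
    have [|/asboolPn/existsNP[[|k]]] := boolP (good _).
    - by move=> _; apply: sumr_ge0.
    - by move=> /not_implyP[].
    - move=> /not_implyP[_ /not_implyP[k_small /negP kN]].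
      rewrite (bigD1 (Ordinal (small_lt k k_small))) //= kN lerDl.
      exact: sumr_ge0.
  rewrite expect_sum; apply: ler_sum => k k_small.
  exact: (expect_nonvanishing_le ps_card p_itv g_itv n_gt1 eps_itv c_ge (small_m _ k_small)).
(* At most n dimensions, each failing with probability at most [2 * n^(-3)]; and [n^(-2)] is at most
   [harmonic n], which is 1 / (n + 1), since [n + 1 <= n^2] for [n > 1]. *)
have sum_le : \sum_(k < n | small k.+1) 2 * expR (- 3 * y) <= 2 * harmonic n.
  apply: (@le_trans _ _ (\sum_(k < n) 2 * expR (- 3 * y))).
    by rewrite big_mkcond ler_sum // => k _; case: ifP => // _; rewrite mulr_ge0 ?expR_ge0.
  rewrite sumr_const card_ord -[leLHS]mulr_natr -mulrA ler_wpM2l //.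
  rewrite mulNr expRN expRM_natl expRy /harmonic.
  have n_gt0 : 0 < n%:R :> R by rewrite ltr0n ltnW.
  rewrite mulrC ler_pdivrMr ?exprn_gt0 // mulrC ler_pdivlMr ?ltr0n //.
  rewrite [n%:R ^+ 3]exprS ler_wpM2l ?ler0n // -natrX ler_nat -mulnn.
  apply: (@leq_trans (2 * n)); first by rewrite mul2n -addnn -addn1 leq_add2l ltnW.
  by rewrite leq_mul2r n_gt1 orbT.
apply/andP; split; move: total bad_le sum_le bad_ge0; lra.
Qed.

Local Open Scope classical_set_scope.
Local Open Scope ring_scope.

Theorem theorem7p1 (R : realType) (p P : R)
  (ps : forall n : nat, {set 'I_n.+1} -> R)
  (hp0 : 0 < p) (hpP : p <= P) (hP1 : P < 1)
  (hbounds : forall (n : nat) (s : {set 'I_n.+1}),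
      s != finset.set0 -> s != finset.setT -> p <= ps n s <= P)
  (hhomog : forall (n : nat) (s t : {set 'I_n.+1}),
      #|s| = #|t| -> ps n s = ps n t)
  (delta0 : R) (hdelta0 : 0 < delta0) :
  (fun n : nat =>
     lower_prob (ps n) (fun Y =>
       `[< forall j : nat, (0 < j)%N ->
           (j%:R <= logb 2 (logb p^-1 n%:R) - 1 - delta0) ->
           homology_vanishes Y j >]))
    @ \oo --> (1 : R).
Proof.
have p_itv : 0 < p < 1 by rewrite hp0 (le_lt_trans hpP hP1).
have [c [n0 params]] := eventually_large p_itv hdelta0.
(* By homogeneity the initial segment of size [i] represents all faces of that size. Sizes of no
   proper face get the value [p], so that the bounds hold for every [i]. *)
pose g n i : R :=
  if (0 < i <= n)%N then ps n [set v : 'I_n.+1 | (v < i)%N]%SET else p.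
have g_card n (s : {set 'I_n.+1}) : s \in proper_faces n.+1 -> ps n s = g n #|s|.
  rewrite finset.inE => /andP[s0 sT]; rewrite /g finset.card_gt0 s0 /=.
  have s_lt : (#|s| < n.+1)%N.
    rewrite ltnNge; apply: contra sT => s_ge.
    by rewrite finset.eqEcard finset.subsetT finset.cardsT card_ord.
  by rewrite -ltnS s_lt; apply: hhomog; rewrite card_ord_lt // ltnW.
have g_itv n i : p <= g n i <= 1.
  rewrite /g; case: ifP => [/andP[i_gt0 i_le]|_]; last by rewrite lexx ltW // (le_lt_trans hpP).
  have sz := card_ord_lt (leqW i_le).
  have /andP[-> le_P] : p <= ps n [set v : 'I_n.+1 | (v < i)%N]%SET <= P.
    apply: hbounds; first by rewrite -finset.card_gt0 sz.
    by apply: contraTneq i_le => iT; rewrite -ltnNge -sz iT finset.cardsT card_ord.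
  by rewrite (le_trans le_P) // ltW.
apply: (@squeeze_cvgr _ _ _ _ (fun n => 1 - 2 * harmonic n) (fun=> 1)).
- exists n0 => // n /= n_ge.
  exact: (lower_prob_ge (@g_card n) p_itv (g_itv n) hdelta0 (params n n_ge)).
- have lim : (fun n => 1 - 2 * harmonic n : R) @ \oo --> 1 - 2 * (0 : R).
    by apply: cvgB; [exact: cvg_cst | apply: cvgMl_tmp; exact: cvg_harmonic].
  by rewrite mulr0 subr0 in lim.
- exact: cvg_cst.
Qed.
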